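(* Let $n\geq 2$, let $F\in\mathcal{O}(D;\Omega_n)$, and let $\zeta_1,\zeta_2\in D$. Let $W_j=F(\zeta_j)$, $j=1,2$, and let $d_j$ be the degree of the minimal polynomial of $W_j$, $j=1,2$. Then $$ \max\left\{\max_{\mu\in\sigma(W_2)}\left[\mathsf{dist}_{\mathcal{M}}(\mu;\sigma(W_1))^{d_1}\right],\ \max_{\lambda\in\sigma(W_1)}\left[\mathsf{dist}_{\mathcal{M}}(\lambda;\sigma(W_2))^{d_2}\right]\right\}\ \leq\ \left|\frac{\zeta_1-\zeta_2}{1-\overline{\zeta_2}\zeta_1}\right|. $$ Furthermore, this inequality is sharp in the following sense: for every $n\ge 2$ and any two points $z,w\in D$, there exists a mapping $\mathscr{F}^{z,w}\in\mathcal{O}(D;\Omega_n)$ such that $$ \max\left\{\max_{\mu\in\sigma(\mathscr{F}^{z,w}(w))}\left[\mathsf{dist}_{\mathcal{M}}(\mu;\sigma(\mathscr{F}^{z,w}(z)))^{d(z)}\right],\ \max_{\lambda\in\sigma(\mathscr{F}^{z,w}(z))}\left[\mathsf{dist}_{\mathcal{M}}(\lambda;\sigma(\mathscr{F}^{z,w}(w)))^{d(w)}\right]\right\}\ =\ \left|\frac{z-w}{1-\overline{w}z}\right|, $$ where $d(z)$ (resp. $d(w)$) is the degree of the minimal polynomial of $\mathscr{F}^{z,w}(z)$ (resp. $\mathscr{F}^{z,w}(w)$).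
   Context: $D$ denotes the open unit disc in $\mathbb{C}$. $M_n(\mathbb{C})$ is the space of $n\times n$ complex matrices; for $W\in M_n(\mathbb{C})$, $\sigma(W)$ is its spectrum (set of eigenvalues) and $r(W)$ its spectral radius. The spectral unit ball is $\Omega_n:=\{W\in M_n(\mathbb{C}): r(W)<1\}$. For complex domains $\Omega$ and $G$, $\mathcal{O}(\Omega;G)$ denotes the class of holomorphic mappings of $\Omega$ into $G$. For a (non-empty) compact subset $K\subsetneq D$ and $\zeta\in D$, define $$\mathsf{dist}_{\mathcal{M}}(\zeta;K):=\min_{z\in K}\left|\frac{\zeta-z}{1-\overline{z}\zeta}\right|.$$ *)

(* Defs.v *)
From HB Require Import structures.
From mathcomp Require Import all_boot all_order all_algebra.
From mathcomp Require Import complex.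
From mathcomp Require Import boolp classical_sets functions cardinality reals.
From mathcomp Require Import topology normedtype derive.

Set Implicit Arguments.
Unset Strict Implicit.
Unset Printing Implicit Defensive.

Import Order.TTheory GRing.Theory Num.Theory.
Import numFieldNormedType.Exports.
Import Normc.

Local Open Scope classical_set_scope.
Local Open Scope complex_scope.
Local Open Scope ring_scope.

(* The greatest (least) element of A, which must belong to A; the value is the
   default 0 when there is none. [set_maxP] and [set_minP] below show that the
   default is never used for finite nonempty sets, hence never for sets indexed
   by a spectrum ([spectrum_finite], [spectrum_neq0]). *)
Definition set_max (R : realType) (A : set R) : R := xget 0 (A `&` ubound A).
Definition set_min (R : realType) (A : set R) : R := xget 0 (A `&` lbound A).

Definition unit_disc (R : realType) : set R[i] := [set z | normc z < 1].

Definition mobius_dist (R : realType) (a b : R[i]) : R :=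
  normc ((a - b) / (1 - conjc b * a)).

(* Meant for K a nonempty compact subset of the unit disc. *)
Definition dist_M (R : realType) (a : R[i]) (K : set R[i]) : R :=
  set_min [set mobius_dist a z | z in K].

Definition spectrum (R : realType) (n : nat) (W : 'M[R[i]]_n) : set R[i] :=
  [set a | eigenvalue W a].

Definition spectral_radius (R : realType) (n : nat) (W : 'M[R[i]]_n) : R :=
  set_max [set normc a | a in spectrum W].

Definition spectral_unit_ball (R : realType) (n : nat) : set 'M[R[i]]_n :=
  [set W | spectral_radius W < 1].

Definition minpoly_degree (R : realType) (n : nat) (W : 'M[R[i]]_n.+1) : nat :=
  (size (mxminpoly W)).-1.

(* Maps are total functions; only their values on the open set U matter, since
   derivability along 1 over the scalar field R[i] (complex differentiability)
   is local. *)
Definition holomorphic_maps (R : realType) (U : set R[i])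
    (V : normedModType R[i]) (G : set V) : set (R[i]^o -> V) :=
  [set F : R[i]^o -> V | forall z : R[i]^o, U z -> G (F z) /\ derivable F z 1].

Lemma set_maxP (R : realType) (A : set R) : finite_set A -> A !=set0 ->
  A (set_max A) /\ forall x, A x -> x <= set_max A.
Proof.
move=> /finite_seqP[s ->] [x0 x0s].
rewrite /set_max; case: xgetP => [y _ []//|/= noM]; exfalso.
have [y ys yM] : exists2 y, y \in s & forall x, x \in s -> x <= y.
  elim: s {noM} x0 x0s => // a s IH x0 _.
  case: s IH => [_|b s IH].
    by exists a; rewrite ?mem_head// => x; rewrite inE => /eqP ->.
  have [//|y ys yM] := IH b; first exact: mem_head.
  case: (leP y a) => ya.
    exists a; rewrite ?mem_head// => x; rewrite in_cons => /orP[/eqP->//|/yM].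
    by move=> /le_trans; apply.
  exists y; first by rewrite in_cons ys orbT.
  by move=> x; rewrite in_cons => /orP[/eqP->|/yM//]; exact: ltW.
by apply: (noM y); split.
Qed.

Lemma set_minP (R : realType) (A : set R) : finite_set A -> A !=set0 ->
  A (set_min A) /\ forall x, A x -> set_min A <= x.
Proof.
move=> finA [a Aa].
have [||[m Am mE] mM] := @set_maxP R [set - x | x in A].
- exact: finite_image.
- by exists (- a), a.
rewrite /set_min; case: xgetP => [y _ []//|/= noM]; exfalso.
apply: (noM m); split => // x Ax.
by rewrite -lerN2 mE; apply: mM; exists x.
Qed.

Lemma spectrum_finite (R : realType) (n : nat) (W : 'M[R[i]]_n) :
  finite_set (spectrum W).
Proof.
have [s sE] := closed_field_poly_normal (char_poly W).
apply: (@sub_finite_set _ _ [set` s]); last exact: finite_seq.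
move=> a /=; rewrite /spectrum /= eigenvalue_root_char sE rootZ ?root_prod_XsubC//.
by rewrite lead_coef_eq0 monic_neq0 // char_poly_monic.
Qed.

Lemma spectrum_neq0 (R : realType) (n : nat) (W : 'M[R[i]]_n.+1) :
  spectrum W !=set0.
Proof.
have /closed_rootP[a aW] : size (char_poly W) != 1%N by rewrite size_char_poly.
by exists a; rewrite /spectrum /= eigenvalue_root_char.
Qed.

(* Main.v *)
Require Import Defs.
From HB Require Import structures.
From mathcomp Require Import all_boot all_order all_algebra.
From mathcomp Require Import complex.
From mathcomp Require Import boolp classical_sets functions cardinality reals.
From mathcomp Require Import topology normedtype derive.
From mathcomp Require Import ring lra.

Import Order.TTheory GRing.Theory Num.Theory.
Import numFieldNormedType.Exports.
Import Normc.

Local Open Scope classical_set_scope.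
Local Open Scope complex_scope.
Local Open Scope ring_scope.

(** Let P be the minimal polynomial of [F z1], with roots a, let
    B(t) = prod (t - a) / (1 - conj(a) t) be the associated Blaschke product, and
    let psi be the Moebius map of the disc vanishing at z1.  Then B(F(z1)) = 0, so
    G := B(F) / psi is holomorphic off z1 and bounded near z1, and the eigenvalues
    of G(z) have modulus at most 1 / |psi(z)|.  The coefficients c of the
    characteristic polynomial of G^k are thus asymptotically bounded by 3^n at the
    boundary of the disc, and the maximum principle for psi * c bounds them at z2
    independently of k.  Hence so are the eigenvalues (B(mu) / psi(z2))^k of
    G(z2)^k, which forces |B(mu)| <= |psi(z2)|; finally |B(mu)| is a product of
    deg P Moebius distances from mu to the spectrum of [F z1].  Sharpness is
    attained by z |-> z I.

    The maximum principle is needed for functions that are merely complex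
    differentiable.  Goursat's subdivision argument is run on trapezoid sums,
    which are exact on affine functions and additive under subdivision of a
    square, so no integral is needed.  It yields |f(p)| <= 2 max |f| over an
    annulus around p, and applying this to powers of f removes the factor 2. *)

(** * The complex modulus and subdivision of squares *)

Section ComplexModulus.
Variable R : realType.
Local Notation C := R[i].
Implicit Types z w : C.

Lemma normc_ge0 z : 0 <= normc z.
Proof. by case: z => a b; rewrite /normc sqrtr_ge0. Qed.

Lemma normc_triangle z w : normc (z + w) <= normc z + normc w.
Proof. exact: (@le_normcD R z w). Qed.

Lemma normc_opp z : normc (- z) = normc z.
Proof. exact: (@normcN R z). Qed.

Lemma normc_subC z w : normc (z - w) = normc (w - z).
Proof. by rewrite -normc_opp opprB. Qed.

Lemma normc_triangleB z w : normc (z - w) <= normc z + normc w.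
Proof. by rewrite -[normc w]normc_opp; exact: normc_triangle. Qed.

Lemma normc_eq0 z : (normc z == 0) = (z == 0).
Proof. by apply/eqP/eqP => [/eq0_normc//|->]; exact: normc0. Qed.

Lemma normc_gt0 z : (0 < normc z) = (z != 0).
Proof. by rewrite lt_neqAle eq_sym normc_eq0 normc_ge0 andbT. Qed.

Lemma normcX z n : normc (z ^+ n) = normc z ^+ n.
Proof. by elim: n => [|n IH]; rewrite ?expr0 ?normc1// !exprS normcM IH. Qed.

Lemma normc_sqr z : normc z ^+ 2 = complex.Re z ^+ 2 + complex.Im z ^+ 2.
Proof. by case: z => a b; rewrite sqr_sqrtr// addr_ge0 ?sqr_ge0. Qed.

Lemma normc_conj z : normc z^* = normc z.
Proof. by case: z => a b; rewrite /= sqrrN. Qed.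

Lemma normc_real (x : R) : normc x%:C = `|x|.
Proof. by rewrite /= expr0n addr0 sqrtr_sqr. Qed.

Lemma normc_i : normc ('i : C) = 1.
Proof. by rewrite /= expr0n add0r expr1n sqrtr1. Qed.

Lemma normc_Im z : `|complex.Im z| <= normc z.
Proof.
by case: z => a b /=;
  rewrite -sqrtr_sqr ler_sqrt ?ler_wpDl ?sqr_ge0// addr_ge0 ?sqr_ge0.
Qed.

Lemma normc_Re z : `|complex.Re z| <= normc z.
Proof.
by case: z => a b /=;
  rewrite -sqrtr_sqr ler_sqrt ?ler_wpDr ?sqr_ge0// addr_ge0 ?sqr_ge0.
Qed.

Lemma normr_normc (z : C) : `|z| = (normc z)%:C.
Proof. by []. Qed.

Lemma normc_half z : normc (z / 2) = normc z / 2.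
Proof.
by rewrite normcM normcV -(rmorph_nat (real_complex R) 2) normc_real ger0_norm.
Qed.

End ComplexModulus.

Section DyadicSquares.
Variable R : realType.
Local Notation C := R[i].
Implicit Types a s z w : C.

Lemma exprn_unbounded (x M : R) : 1 < x -> exists k, M < x ^+ k.
Proof.
move=> x1; have x1' : 0 < x - 1 by rewrite subr_gt0.
have bernoulli k : 1 + k%:R * (x - 1) <= x ^+ k.
  elim: k => [|k IH]; first by rewrite expr0 mul0r addr0.
  rewrite exprSr (le_trans _ (ler_wpM2r (ltW (lt_trans ltr01 x1)) IH))//.
  have : 0 <= k%:R * (x - 1) * (x - 1) by rewrite !mulr_ge0// ltW.
  by rewrite -natr1; lra.
exists (Num.bound `|M / (x - 1)|); apply: lt_le_trans (bernoulli _).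
have : M / (x - 1) < (Num.bound `|M / (x - 1)|)%:R.
  by rewrite (le_lt_trans (ler_norm _))// archi_boundP.
by rewrite ltr_pdivrMr//; lra.
Qed.

(** The supremum of the left endpoints works, because every right endpoint is an upper bound of all
    left endpoints. *)
Lemma nested_segments (x r : nat -> R) : (forall k, 0 <= r k) ->
  (forall k, x k <= x k.+1) -> (forall k, x k.+1 + r k.+1 <= x k + r k) ->
  exists X, forall k, x k <= X <= x k + r k.
Proof.
move=> r0 xS xrS.
have xle k l : x k <= x (k + l)%N.
  by elim: l => [|l IH]; rewrite ?addn0 ?addnS// (le_trans IH).
have xrle k l : x (k + l)%N + r (k + l)%N <= x k + r k.
  by elim: l => [|l IH]; rewrite ?addn0 ?addnS// (le_trans (xrS _)).
have ub k l : x l <= x k + r k.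
  by rewrite (le_trans (xle l k))// (le_trans _ (xrle k l))// addnC lerDl.
have hs : has_sup (range x).
  by split; [exists (x 0%N), 0%N|exists (x 0%N + r 0%N) => _ [l _ <-]].
exists (sup (range x)) => k; apply/andP; split.
  by apply: sup_upper_bound => //; exists k.
by apply: ge_sup => [|_ [l _ <-]//]; exists (x 0%N), 0%N.
Qed.

(* For complex [s] the closed square may be rotated; its sides from the corner
   [a] are [s] and ['i * s]. *)
Definition in_square a s z := exists x y : R,
  [/\ 0 <= x <= 1, 0 <= y <= 1 & z = a + (x%:C + 'i * y%:C) * s].

Lemma in_square_dist a s z w : in_square a s z -> in_square a s w ->
  normc (w - z) <= 2 * normc s.
Proof.
move=> [x [y [x01 y01 ->]]] [x' [y' [x01' y01' ->]]].
have -> : a + (x'%:C + 'i * y'%:C) * s - (a + (x%:C + 'i * y%:C) * s)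
  = ((x' - x)%:C + 'i * (y' - y)%:C) * s by rewrite !rmorphB/=; ring.
rewrite normcM ler_wpM2r ?normc_ge0// (le_trans (normc_triangle _ _ _))//.
rewrite normcM normc_i !normc_real mul1r -[2]/(1 + 1) lerD// ler_norml; lra.
Qed.

Lemma in_square_corner a s : in_square a s a.
Proof. by exists 0, 0; rewrite lexx ler01; split => //;
  rewrite mulr0 addr0 mul0r addr0. Qed.

(** Bisection: if [P] fails on a square, it fails on one of its quarters. Repeating this gives
    nested squares that shrink to a point, where the local hypothesis is contradicted. The principle
    stands in for compactness, both in Goursat's theorem and in [disc_max]. *)
Lemma square_induction (P : C -> C -> Prop) a s :
  (forall a s, P a (s / 2) -> P (a + s / 2) (s / 2) ->
     P (a + 'i * (s / 2)) (s / 2) -> P (a + s / 2 + 'i * (s / 2)) (s / 2) ->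
     P a s) ->
  (forall z, in_square a s z -> exists2 d : R, 0 < d &
     forall a' s', in_square a' s' z ->
       (forall w, in_square a' s' w -> in_square a s w) ->
       normc s' < d -> P a' s') ->
  P a s.
Proof.
move=> Pq Ploc; apply: contrapT => nP.
pose r k : R := 2^-1 ^+ k.
have r_ge0 k : 0 <= r k by rewrite exprn_ge0// invr_ge0.
have r_gt0 k : 0 < r k by rewrite exprn_gt0// invr_gt0.
have rS k : r k.+1 = r k / 2 by rewrite /r exprSr.
(* The nested squares are tracked by the coordinates [u] of their corners in the unit square, so
   that the limit point is found one real coordinate at a time. *)
pose A (u : R * R) := a + (u.1%:C + 'i * u.2%:C) * s.
pose bad (u : R * R) k := ~ P (A u) ((r k)%:C * s).
(* The existential stands outside the implication, so that a choice function is defined for all [u]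
   and [k]. *)
have step u k : exists v : R * R, bad u k ->
    [/\ bad v k.+1, u.1 <= v.1, u.2 <= v.2,
       v.1 + r k.+1 <= u.1 + r k & v.2 + r k.+1 <= u.2 + r k].
  have half2 : r k.+1 + r k.+1 = r k by rewrite rS; lra.
  have r1_ge0 := r_ge0 k.+1.
  pose v (b c : bool) := (u.1 + b%:R * r k.+1, u.2 + c%:R * r k.+1) : R * R.
  suff [[b [c Hbc]]|nbad] : (exists b c, bad (v b c) k.+1) \/ ~ bad u k.
  - by exists (v b c) => _; split => //=; case: b {Hbc}; case: c => /=; lra.
  - by exists u => /nbad.
  apply: contrapT => /not_orP[H] /contrapT Hu; apply: Hu.
  have good b c : P (A (v b c)) ((r k.+1)%:C * s).
    by apply: contrapT => ?; apply: H; exists b, c.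
  have sE : (r k)%:C * s / 2 = (r k.+1)%:C * s.
    by rewrite -half2 rmorphD/=; field.
  apply: Pq; rewrite sE.
  + by move: (good false false); rewrite /v !mul0r !addr0 -surjective_pairing.
  + move: (good true false); rewrite /v mul0r !addr0 mul1r.
    by rewrite /A /= rmorphD/=; congr P; ring.
  + move: (good false true); rewrite /v mul0r !addr0 mul1r.
    by rewrite /A /= rmorphD/=; congr P; ring.
  + move: (good true true); rewrite /v !mul1r.
    by rewrite /A /= !rmorphD/=; congr P; ring.
pose f u k := projT1 (cid (step u k)).
pose u := fix u k : R * R := if k is k'.+1 then f (u k') k' else (0, 0).
have ubad k : bad (u k) k.
  elim: k => [|k IH /=]; last by rewrite /f; case: cid => v /= /(_ IH)[].
  by rewrite /bad /A /= mulr0 !addr0 mul0r addr0 /r expr0 mul1r.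
have uS k : [/\ (u k).1 <= (u k.+1).1, (u k).2 <= (u k.+1).2,
    (u k.+1).1 + r k.+1 <= (u k).1 + r k & (u k.+1).2 + r k.+1 <= (u k).2 + r k].
  by have /(_ (ubad k))[_ ? ? ? ?] := projT2 (cid (step (u k) k)); split.
have [||X HX] := @nested_segments (fun k => (u k).1) r r_ge0.
- by move=> k; case: (uS k).
- by move=> k; case: (uS k).
have [||Y HY] := @nested_segments (fun k => (u k).2) r r_ge0.
- by move=> k; case: (uS k).
- by move=> k; case: (uS k).
have u_ge0 k : 0 <= (u k).1 /\ 0 <= (u k).2.
  elim: k => [//|k [H1 H2]]; case: (uS k) => H3 H4 _ _.
  by split; [exact: le_trans H3|exact: le_trans H4].
have u_le1 k : (u k).1 + r k <= 1 /\ (u k).2 + r k <= 1.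
  elim: k => [|k [H1 H2]]; first by rewrite /r /= expr0 add0r.
  by case: (uS k) => _ _ H3 H4; split; [exact: le_trans H1|exact: le_trans H2].
have inA k : in_square (A (u k)) ((r k)%:C * s) (A (X, Y)).
  exists ((X - (u k).1) / r k), ((Y - (u k).2) / r k).
  rewrite !ler_pdivrMr// !divr_ge0 ?subr_ge0//; last first.
  - by case/andP: (HX k).
  - by case/andP: (HY k).
  rewrite !mul1r !lerBlDl; case/andP: (HX k) => _ ->; case/andP: (HY k) => _ ->.
  split => //; rewrite /A /= !rmorphM /= fmorphV /= !rmorphB /=.
  have : (r k)%:C != 0 :> C by rewrite eq_complex /= eqxx andbT gt_eqF.
  by move=> ?; field.
have [|d d0 Pd] := Ploc (A (X, Y)).
  exists X, Y; split => //.
  - by have := HX 0%N; rewrite /= /r expr0 add0r.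
  - by have := HY 0%N; rewrite /= /r expr0 add0r.
have [k Hk] : exists k, r k * normc s < d.
  have [k] : exists k, 2^-1 ^+ k < d / (normc s + 1).
    have [k] := @exprn_unbounded 2 ((normc s + 1) / d) ltac:(lra).
    have d' : 0 < (normc s + 1) / d by rewrite divr_gt0// ltr_wpDl ?normc_ge0.
    by exists k; rewrite exprVn -(invf_div (normc s + 1)) ltf_pV2 ?posrE// exprn_gt0.
  move=> Hk; exists k; move: Hk; rewrite ltr_pdivlMr ?ltr_wpDl ?normc_ge0//.
  by apply: le_lt_trans; rewrite ler_wpM2l// lerDl.
apply: (ubad k); apply: Pd => //; last by rewrite normcM normc_real ger0_norm.
move=> w [x [y [/andP[x0 x1] /andP[y0 y1] ->]]].
exists ((u k).1 + x * r k), ((u k).2 + y * r k).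
have [u1 u2] := u_ge0 k; have [v1 v2] := u_le1 k; have rk := r_ge0 k.
split.
- apply/andP; split; first by rewrite addr_ge0// mulr_ge0.
  by rewrite (le_trans _ v1)// lerD2l ler_piMl.
- apply/andP; split; first by rewrite addr_ge0// mulr_ge0.
  by rewrite (le_trans _ v2)// lerD2l ler_piMl.
- by rewrite /A !rmorphD !rmorphM/=; ring.
Qed.

End DyadicSquares.

(** * Goursat's theorem for trapezoid sums *)

Section Holomorphic.
Variable R : realType.
Local Notation C := R[i].
Implicit Types (a s z w : C).

Definition holo_at (f : C -> C) z := derivable (f : C^o -> C^o) z 1.

Lemma holo_cst c z : holo_at (fun=> c) z.
Proof. exact: (@derivable_cst _ C^o C^o). Qed.

Lemma holo_id z : holo_at id z.
Proof. exact: (@derivable_id _ C^o). Qed.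

Lemma holoD f g z : holo_at f z -> holo_at g z -> holo_at (fun w => f w + g w) z.
Proof. exact: (@derivableD _ C^o C^o f g). Qed.

Lemma holoM f g z : holo_at f z -> holo_at g z -> holo_at (fun w => f w * g w) z.
Proof. exact: (@derivableM _ C^o f g). Qed.

Lemma holoB f g z : holo_at f z -> holo_at g z -> holo_at (fun w => f w - g w) z.
Proof. exact: (@derivableB _ C^o C^o f g). Qed.

Lemma holoV f z : f z != 0 -> holo_at f z -> holo_at (fun w => (f w)^-1) z.
Proof. exact: (@derivableV _ C^o f). Qed.

Lemma holoX f n z : holo_at f z -> holo_at (fun w => f w ^+ n) z.
Proof.
move=> fz; elim: n => [|n IH]; first exact: holo_cst.
have -> : (fun w => f w ^+ n.+1) = (fun w => f w * f w ^+ n).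
  by apply/funext => w; rewrite exprS.
exact: holoM.
Qed.

(** The first-order expansion in terms of real moduli; all later estimates start from it rather than
    from filters. Multiplying by [h] also covers [h = 0], which the punctured limit leaves out. *)
Lemma holo_normc (f : C -> C) z : holo_at f z ->
  exists l : C, forall e : R, 0 < e -> exists2 d : R, 0 < d &
    forall h, normc h < d -> normc (f (z + h) - f z - l * h) <= e * normc h.
Proof.
move=> /cvg_ex[l fl]; exists l => e e0.
have : 0 < e%:C :> C by rewrite ltcR.
move/cvgrPdist_le: fl => /[apply]; move=> /nbhs_ballP[d /= d0 Hd].
have [dR d0'] : d = (complex.Re d)%:C /\ 0 < complex.Re d.
  by move: d0; case: (d) => x y; rewrite ltcE /= => /andP[/eqP -> ->].
exists (complex.Re d) => // h hd.
have [->|h0] := eqVneq h 0.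
  by rewrite addr0 mulr0 subrr subr0 normc0 mulr0.
have /Hd : @ball _ (C^o) 0 d h.
  rewrite /ball /= sub0r normrN dR. by rewrite [X in X < _]normr_normc ltcR.
move=> /(_ h0) /=; rewrite normr_normc lecR => H.
have -> : f (z + h) - f z - l * h = - (h * (l - h^-1 * (f (h + z) - f z))).
  by rewrite mulrBr mulrA divff// mul1r (addrC h z); ring.
rewrite normc_opp normcM mulrC ler_wpM2r ?normc_ge0//.
by move: H; rewrite /= -[h *: 1]/(h * 1) mulr1 (addrC h z).
Qed.

Lemma holo_continuous (f : C -> C) z : holo_at f z ->
  forall e : R, 0 < e -> exists2 d : R, 0 < d &
    forall w, normc (w - z) < d -> normc (f w - f z) < e.
Proof.
move=> /holo_normc[l Hl] e e0; have [d d0 Hd] := Hl 1 ltr01.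
have K0 : 0 < 2 + normc l by rewrite ltr_wpDr ?normc_ge0.
exists (Num.min d (e / (2 + normc l))) => [|w]; first by rewrite lt_min d0 divr_gt0.
rewrite lt_min ltr_pdivlMr// => /andP[wd we].
have := Hd _ wd; rewrite (addrC z) subrK mul1r => H.
have -> : f w - f z = (f w - f z - l * (w - z)) + l * (w - z) by ring.
rewrite (le_lt_trans (normc_triangle _ _ _))// normcM.
by move: (normc_ge0 R (w - z)); nra.
Qed.

(** Linear decay at a zero is what keeps the quotient of [H] by [psi] bounded near [z1] later on. *)
Lemma holo_vanishing (f : C -> C) z : holo_at f z -> f z = 0 ->
  exists2 d : R, 0 < d & exists M : R, 0 <= M /\
    forall w, normc (w - z) < d -> normc (f w) <= M * normc (w - z).
Proof.
move=> /holo_normc[l Hl] fz; have [d d0 Hd] := Hl 1 ltr01.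
exists d => //; exists (1 + normc l); split; first by rewrite addr_ge0 ?normc_ge0.
move=> w wd; have := Hd _ wd; rewrite (addrC z) subrK fz subr0 => E.
have -> : f w = (f w - l * (w - z)) + l * (w - z) by ring.
by rewrite (le_trans (normc_triangle _ _ _))// normcM; lra.
Qed.

(** The trapezoid rule for the integral of [g] from [a] to [a + v], with [2 ^ m] equal pieces.
    Recursion on halves makes subdivision an exact identity. *)
Fixpoint edge_sum (g : C -> C) m a v : C :=
  if m is m'.+1 then edge_sum g m' a (v / 2) + edge_sum g m' (a + v / 2) (v / 2)
  else (g a + g (a + v)) / 2 * v.

Definition in_segment a v z := exists2 x : R, 0 <= x <= 1 & z = a + x%:C * v.

Lemma in_segment_halfl a v z : in_segment a (v / 2) z -> in_segment a v z.
Proof.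
move=> [x x01 ->]; exists (x / 2); first lra.
by rewrite rmorphM fmorphV rmorph_nat /=; ring.
Qed.

Lemma in_segment_halfr a v z :
  in_segment (a + v / 2) (v / 2) z -> in_segment a v z.
Proof.
move=> [x x01 ->]; exists (2^-1 + x / 2); first lra.
by rewrite rmorphD rmorphM fmorphV rmorph_nat /=; ring.
Qed.

Lemma in_segment_start a v : in_segment a v a.
Proof. by exists 0; rewrite ?lexx ?ler01// mul0r addr0. Qed.

Lemma in_segment_end a v : in_segment a v (a + v).
Proof. by exists 1; rewrite ?lexx ?ler01// mul1r. Qed.

Lemma edge_sum_bound g m a v (M : R) :
  (forall z, in_segment a v z -> normc (g z) <= M) ->
  normc (edge_sum g m a v) <= M * normc v.
Proof.
elim: m a v => [|m IH] a v gM /=.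
  rewrite normcM normc_half ler_wpM2r ?normc_ge0//.
  have := gM _ (in_segment_start a v); have := gM _ (in_segment_end a v).
  by have := normc_triangle _ (g a) (g (a + v)); lra.
rewrite (le_trans (normc_triangle _ _ _))//.
have -> : M * normc v = M * normc (v / 2) + M * normc (v / 2).
  by rewrite normc_half; lra.
by apply: lerD; apply: IH => z zv; apply: gM;
  [exact: in_segment_halfl|exact: in_segment_halfr].
Qed.

Lemma edge_sum_ImP g m a v (c : R) :
  (forall z, in_segment a v z -> c <= complex.Im (g z * v)) ->
  c <= complex.Im (edge_sum g m a v).
Proof.
have Im_half (x : C) : complex.Im (x / 2) = complex.Im x / 2.
  by rewrite -(rmorph_nat (real_complex R) 2) -fmorphV; case: x => x y /=; lra.
have ImD (x y : C) : complex.Im (x + y) = complex.Im x + complex.Im y.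
  by case: x; case: y.
elim: m a v c => [|m IH] a v c gc /=.
  have := gc _ (in_segment_start a v); have := gc _ (in_segment_end a v).
  by rewrite mulrAC Im_half mulrDl ImD; lra.
have -> : c = c / 2 + c / 2 by lra.
rewrite ImD; apply: lerD; apply: IH => z zv; rewrite mulrA Im_half.
  by have := gc _ (in_segment_halfl _ _ _ zv); lra.
by have := gc _ (in_segment_halfr _ _ _ zv); lra.
Qed.

Lemma edge_sumZ c g m a v :
  edge_sum (fun z => c * g z) m a v = c * edge_sum g m a v.
Proof. by elim: m a v => [|m IH] a v /=; rewrite ?IH; ring. Qed.

(* The trapezoid rule is exact on affine functions. *)
Lemma edge_sum_affine b c m a v :
  edge_sum (fun z => b + c * z) m a v = (b + c * (a + v / 2)) * v.
Proof. by elim: m a v => [|m IH] a v /=; rewrite ?IH; field. Qed.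

Lemma edge_sumB g h m a v :
  edge_sum (fun z => g z - h z) m a v = edge_sum g m a v - edge_sum h m a v.
Proof. by elim: m a v => [|m IH] a v /=; rewrite ?IH; ring. Qed.

(** The discrete contour integral over the boundary of the square, starting at the corner [a] and
    going along [s] first. *)
Definition square_sum g m a s : C :=
  edge_sum g m a s + edge_sum g m (a + s) ('i * s)
  - edge_sum g m (a + 'i * s) s - edge_sum g m a ('i * s).

(** Each inner edge is shared by two quarters that traverse it in opposite directions, so the inner
    contributions cancel. Half an edge carries half of the pieces, whence the drop from [m.+1] to
    [m]. *)
Lemma square_sum_quarters g m a s : square_sum g m.+1 a s =
  square_sum g m a (s / 2) + square_sum g m (a + s / 2) (s / 2) +
  square_sum g m (a + 'i * (s / 2)) (s / 2) +
  square_sum g m (a + s / 2 + 'i * (s / 2)) (s / 2).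
Proof.
rewrite /square_sum /= -!mulrA.
have -> : a + s = a + s / 2 + s / 2 by field.
have -> : a + 'i * s = a + 'i * (s / 2) + 'i * (s / 2) by field.
set t := s / 2.
have -> : a + t + 'i * t + t = a + t + t + 'i * t by ring.
have -> : a + 'i * t + t = a + t + 'i * t by ring.
have -> : a + 'i * t + 'i * t + t = a + t + 'i * t + 'i * t by ring.
by ring.
Qed.

Lemma in_square_edges a s z :
  [\/ in_segment a s z, in_segment (a + s) ('i * s) z,
      in_segment (a + 'i * s) s z | in_segment a ('i * s) z] ->
  in_square R a s z.
Proof.
by case=> -[x x01 ->]; [exists x, 0|exists 1, x|exists x, 1|exists 0, x];
  split; rewrite ?lexx ?ler01//=; ring.
Qed.

Lemma square_sum_bound g m a s (M : R) :
  (forall z, in_square R a s z -> normc (g z) <= M) ->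
  normc (square_sum g m a s) <= 4 * M * normc s.
Proof.
move=> gM.
have is1 : normc ('i * s) = normc s by rewrite normcM normc_i mul1r.
have h1 : normc (edge_sum g m a s) <= M * normc s.
  by apply: edge_sum_bound => z ?; apply/gM/in_square_edges/Or41.
have h2 : normc (edge_sum g m (a + s) ('i * s)) <= M * normc s.
  by rewrite -is1; apply: edge_sum_bound => z ?; apply/gM/in_square_edges/Or42.
have h3 : normc (edge_sum g m (a + 'i * s) s) <= M * normc s.
  by apply: edge_sum_bound => z ?; apply/gM/in_square_edges/Or43.
have h4 : normc (edge_sum g m a ('i * s)) <= M * normc s.
  by rewrite -is1; apply: edge_sum_bound => z ?; apply/gM/in_square_edges/Or44.
rewrite (le_trans (normc_triangleB _ _ _))//.
have := normc_triangleB _ (edge_sum g m a s + edge_sum g m (a + s) ('i * s))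
  (edge_sum g m (a + 'i * s) s).
have := normc_triangle _ (edge_sum g m a s) (edge_sum g m (a + s) ('i * s)).
lra.
Qed.

Lemma square_sum_affine b c m a s : square_sum (fun z => b + c * z) m a s = 0.
Proof. by rewrite /square_sum !edge_sum_affine; field. Qed.

(** A bound proportional to [normc s ^+ 2] is inherited from the four quarters. Locally, [g] is
    replaced by its difference with its affine approximation at [z], which leaves the square sum
    unchanged by [square_sum_affine]. *)
Lemma goursat (g : C -> C) a s :
  (forall z, in_square R a s z -> holo_at g z) ->
  forall e : R, 0 < e -> exists n, forall m, (n <= m)%N ->
    normc (square_sum g m a s) <= e * normc s ^+ 2.
Proof.
move=> dg e e0; apply: (@square_induction R (fun a s => exists n, forall m,
    (n <= m)%N -> normc (square_sum g m a s) <= e * normc s ^+ 2)).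
- move=> {dg}{}a {}s [n1 H1] [n2 H2] [n3 H3] [n4 H4].
  exists (maxn (maxn n1 n2) (maxn n3 n4)).+1 => -[//|m].
  rewrite ltnS !geq_max => /andP[/andP[/H1 {}H1 /H2 {}H2] /andP[/H3 {}H3 /H4 {}H4]].
  rewrite square_sum_quarters; move: H1 H2 H3 H4.
  set u1 := square_sum _ _ _ _; set u2 := square_sum _ _ _ _.
  set u3 := square_sum _ _ _ _; set u4 := square_sum _ _ _ _.
  rewrite normc_half => H1 H2 H3 H4.
  have := normc_triangle _ (u1 + u2 + u3) u4.
  have := normc_triangle _ (u1 + u2) u3.
  have := normc_triangle _ u1 u2; nra.
- move=> z /dg /holo_normc[l Hl].
  (* Points of the small square are within [2 * normc s'] of [z], so the error is at most
     [e / 4 * normc s']; the factor [4 * normc s'] of [square_sum_bound] then gives exactly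
     [e * normc s' ^+ 2]. *)
  have [|d d0 Hd] := Hl (e / 8); first lra.
  exists (d / 2) => [|a' s' az _ s'd]; first lra.
  exists 0%N => m _.
  have -> : square_sum g m a' s' =
      square_sum (fun w => g w - ((g z - l * z) + l * w)) m a' s'.
    rewrite /square_sum !edge_sumB; have := square_sum_affine (g z - l * z) l m a' s'.
    rewrite /square_sum => H; rewrite -[LHS]subr0 -H; ring.
  have -> : e * normc s' ^+ 2 = 4 * (e / 4 * normc s') * normc s' by field.
  apply: square_sum_bound => w aw.
  have dzw := in_square_dist _ _ _ _ _ az aw.
  have -> : g w - (g z - l * z + l * w) = g w - g z - l * (w - z) by ring.
  have wzd : normc (w - z) < d by lra.
  by have := Hd _ wzd; rewrite (addrC z) subrK; nra.
Qed.

Lemma goursat_cvg (g : C -> C) a s :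
  (forall z, in_square R a s z -> holo_at g z) ->
  forall e : R, 0 < e -> exists n, forall m, (n <= m)%N ->
    normc (square_sum g m a s) <= e.
Proof.
move=> dg e e0; have s0 := sqr_ge0 (normc s).
have K0 : 0 < normc s ^+ 2 + 1 by lra.
have [|n Hn] := goursat g a s dg (e / (normc s ^+ 2 + 1)); first exact: divr_gt0.
exists n => m /Hn /le_trans; apply.
by rewrite mulrAC ler_pdivrMr//; nra.
Qed.

(** Boundedness near the corner [a] replaces differentiability there. Quartering repeatedly towards
    [a] leaves three quarters per stage on which [goursat_cvg] applies, and a last corner square
    whose sum is small because its perimeter is. *)
Lemma goursat_corner (g : C -> C) a s (d M : R) : 0 < d ->
  (forall z, normc (z - a) < d -> normc (g z) <= M) ->
  (forall z, in_square R a s z -> z != a -> holo_at g z) ->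
  forall e : R, 0 < e -> exists n, forall m, (n <= m)%N ->
    normc (square_sum g m a s) <= e.
Proof.
move=> d0 gM dg e e0.
have M0 : 0 <= M by apply: le_trans (gM a _); rewrite ?normc_ge0// subrr normc0.
have [k Hk] : exists k, forall z, in_square R a (s / 2 ^+ k) z ->
    normc (z - a) < d /\ 4 * M * normc (s / 2 ^+ k) <= e / 2.
  (* The first summand puts the last corner square inside the ball of radius [d]; the second makes
     its sum at most [e / 2]. *)
  have [k] := @exprn_unbounded R 2 (2 * normc s / d + 8 * M * normc s / e) ltac:(lra).
  have k0 : 0 < 2 ^+ k :> R by rewrite exprn_gt0.
  have ns := normc_ge0 R s.
  have : 0 <= 2 * normc s / d by rewrite divr_ge0 ?mulr_ge0// ltW.
  have : 0 <= 8 * M * normc s / e by rewrite divr_ge0 ?mulr_ge0// ltW.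
  move=> h1 h2 h3.
  have : 8 * M * normc s / e < 2 ^+ k by lra.
  have : 2 * normc s / d < 2 ^+ k by lra.
  rewrite !ltr_pdivrMr// => h4 h5.
  have sE : normc (s / 2 ^+ k) = normc s / 2 ^+ k.
    by rewrite normcM normcV normcX -(rmorph_nat (real_complex R) 2) normc_real
      ger0_norm.
  exists k => z zs; split.
    apply: (le_lt_trans (in_square_dist _ _ _ _ _ (in_square_corner _ _ _) zs)).
    by rewrite sE mulrA ltr_pdivrMr//; lra.
  by rewrite sE mulrA ler_pdivrMr//; lra.
have e2 : 0 < e / 2 by lra.
suff [n Hn] : exists n, forall m, (n <= m)%N ->
    normc (square_sum g m a s) <= e / 2 + 4 * M * normc (s / 2 ^+ k).
  exists n => m /Hn; case: (Hk a (in_square_corner _ _ _)); lra.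
have {e0 Hk} {}gM : forall z, in_square R a (s / 2 ^+ k) z -> normc (g z) <= M.
  by move=> z /Hk[/gM].
move: (e / 2) e2 => {}e e0.
elim: k s dg gM e e0 => [|k IH] s dg gM e e0.
  exists 0%N => m _; move: gM; rewrite expr0 divr1 => gM.
  by have := square_sum_bound g m a s M gM; lra.
have [s0|s0] := eqVneq s 0.
  exists 0%N => m _; rewrite s0 mul0r normc0 mulr0 addr0.
  move: gM; rewrite s0 mul0r => /(square_sum_bound g m); rewrite normc0 mulr0.
  by move/le_trans; apply; exact: ltW.
have sk : s / 2 ^+ k.+1 = s / 2 / 2 ^+ k by rewrite exprS invfM mulrA.
have real_half (x : R) : x%:C / 2 = (x / 2)%:C :> C.
  by rewrite rmorphM fmorphV rmorph_nat.
have half b (x y x0 y0 : R) : b = a + (x0%:C + 'i * y0%:C) * s ->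
   x0 + x / 2 != 0 \/ y0 + y / 2 != 0 ->
   0 <= x0 + x / 2 <= 1 -> 0 <= y0 + y / 2 <= 1 ->
   holo_at g (b + (x%:C + 'i * y%:C) * (s / 2)).
  move=> -> nz x01 y01.
  have -> : a + (x0%:C + 'i * y0%:C) * s + (x%:C + 'i * y%:C) * (s / 2) =
     a + ((x0 + x / 2)%:C + 'i * (y0 + y / 2)%:C) * s.
    by rewrite !rmorphD/= -!real_half; field.
  apply: dg; first by exists (x0 + x / 2), (y0 + y / 2).
  rewrite -subr_eq0 [a + _]addrC addrK mulf_neq0//.
  apply/eqP => /eqP; rewrite eq_complex /= => /andP[/eqP].
  rewrite !(mul0r, mulr0, mul1r, addr0, add0r, subr0) => h1 /eqP h2.
  by case: nz; rewrite ?h1 ?h2 ?eqxx.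
have half1 : (2^-1)%:C = 2^-1 :> C by rewrite fmorphV rmorph_nat.
have e4 : 0 < e / 4 by lra.
have [|z|n1 H1] := IH (s / 2) _ _ (e / 4) e4.
- move=> z [x [y [x01 y01 ->]]] za.
  apply: (half _ x y 0 0); [by rewrite mulr0 addr0 mul0r addr0| |lra|lra].
  move: za; apply: contraPP => /not_orP[/negP/negPn/eqP h1 /negP/negPn/eqP h2].
  have -> : x = 0 by lra.
  have -> : y = 0 by lra.
  by rewrite mulr0 addr0 mul0r addr0 eqxx.
- by rewrite -sk; exact: gM.
have [|n2 H2] := goursat_cvg g (a + s / 2) (s / 2) _ (e / 4) e4.
  move=> z [x [y [x01 y01 ->]]].
  apply: (half _ x y 2^-1 0); [by rewrite half1; ring| |lra|lra].
  by left; rewrite gt_eqF//; lra.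
have [|n3 H3] := goursat_cvg g (a + 'i * (s / 2)) (s / 2) _ (e / 4) e4.
  move=> z [x [y [x01 y01 ->]]].
  apply: (half _ x y 0 2^-1); [by rewrite half1; ring| |lra|lra].
  by right; rewrite gt_eqF//; lra.
have [|n4 H4] := goursat_cvg g (a + s / 2 + 'i * (s / 2)) (s / 2) _ (e / 4) e4.
  move=> z [x [y [x01 y01 ->]]].
  apply: (half _ x y 2^-1 2^-1); [by rewrite half1; ring| |lra|lra].
  by right; rewrite gt_eqF//; lra.
exists (maxn (maxn n1 n2) (maxn n3 n4)).+1 => -[//|m].
rewrite ltnS !geq_max => /andP[/andP[/H1 {}H1 /H2 {}H2] /andP[/H3 {}H3 /H4 {}H4]].
rewrite square_sum_quarters sk; move: H1 H2 H3 H4.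
set u1 := square_sum _ _ _ _; set u2 := square_sum _ _ _ _.
set u3 := square_sum _ _ _ _; set u4 := square_sum _ _ _ _ => H1 H2 H3 H4.
have := normc_triangle _ (u1 + u2 + u3) u4.
have := normc_triangle _ (u1 + u2) u3.
have := normc_triangle _ u1 u2; lra.
Qed.
End Holomorphic.

(** * The maximum principle *)

Section MaximumPrinciple.
Variable R : realType.
Local Notation C := R[i].
Implicit Types (a s t z w p : C).

Lemma cartesianE (x y : R) : (x +i* y)%C = x%:C + 'i * y%:C.
Proof. exact: (complexE (x +i* y)%C). Qed.

(** The two sides of the square that do not meet the corner [p]. Over the four rotations of [t] they
    form the boundary of a square centred at [p]. *)
Let outer (g : C -> C) m p t :=
  edge_sum R g m (p + t) ('i * t) - edge_sum R g m (p + 'i * t) t.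

Lemma outer_sum g m p t :
  outer g m p t + outer g m p ('i * t) + outer g m p (- t) + outer g m p (- ('i * t)) =
  square_sum R g m p t + square_sum R g m p ('i * t) +
  square_sum R g m p (- t) + square_sum R g m p (- ('i * t)).
Proof.
rewrite /square_sum /outer.
have -> : 'i * ('i * t) = - t by rewrite mulrA -expr2 sqr_i mulN1r.
have -> : 'i * (- ('i * t)) = t by rewrite mulrN mulrA -expr2 sqr_i mulN1r opprK.
have -> : 'i * (- t) = - ('i * t) by rewrite mulrN.
by ring.
Qed.

Lemma outer_bound (f : C -> C) m p t (M : R) : t != 0 ->
  (forall z, normc t <= normc (z - p) <= 2 * normc t -> normc (f z) <= M) ->
  normc (outer (fun z => f z * (z - p)^-1) m p t) <= 2 * M.
Proof.
move=> t0 fM.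
have nt : 0 < normc t by rewrite normc_gt0.
have nit : normc ('i * t) = normc t by rewrite normcM normc_i mul1r.
have ann (x y : R) : 1 <= x ^+ 2 + y ^+ 2 <= 4 ->
    normc t <= normc ((x +i* y)%C * t) <= 2 * normc t.
  move=> xy; rewrite normcM ler_peMl ?normc_ge0 ?ler_wpM2r ?normc_ge0//.
    have -> : 2 = Num.sqrt 4 :> R by rewrite (_ : 4 = 2 ^+ 2) ?sqrtr_sqr
      ?ger0_norm//; ring.
    by rewrite /= ler_sqrt//; lra.
  by rewrite /= -[leLHS]sqrtr1 ler_sqrt//; lra.
have key z : normc t <= normc (z - p) <= 2 * normc t ->
    normc (f z * (z - p)^-1) <= M / normc t.
  move=> zp; have := fM _ zp; case/andP: zp => tz _ fz.
  have zp0 : 0 < normc (z - p) by exact: lt_le_trans tz.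
  rewrite normcM normcV ler_pM ?normc_ge0 ?invr_ge0 ?normc_ge0//.
  by rewrite lef_pV2 ?posrE.
have E1 : normc (edge_sum R (fun z => f z * (z - p)^-1) m (p + t) ('i * t)) <= M.
  have -> : M = M / normc t * normc ('i * t) by rewrite nit mulfVK// gt_eqF.
  apply: edge_sum_bound => z [x x01 ->]; apply: key.
  have -> : p + t + x%:C * ('i * t) - p = (1 +i* x)%C * t.
    by rewrite cartesianE rmorph1; ring.
  by apply: ann; nra.
have E2 : normc (edge_sum R (fun z => f z * (z - p)^-1) m (p + 'i * t) t) <= M.
  have -> : M = M / normc t * normc t by rewrite mulfVK// gt_eqF.
  apply: edge_sum_bound => z [x x01 ->]; apply: key.
  have -> : p + 'i * t + x%:C * t - p = (x +i* 1)%C * t.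
    by rewrite cartesianE rmorph1; ring.
  by apply: ann; nra.
by have := normc_triangleB R (edge_sum R (fun z => f z * (z - p)^-1) m (p + t) ('i * t))
  (edge_sum R (fun z => f z * (z - p)^-1) m (p + 'i * t) t); rewrite /outer; lra.
Qed.

(** A quarter of the winding integral around [p], whose limit is ['i] times pi / 2. A crude bound
    suffices: on each of the two sides the integrand has imaginary part [(1 + x ^+ 2)^-1], which is
    at least 1/2. *)
Lemma outer_inv_Im m p t : t != 0 ->
  1 <= complex.Im (outer (fun z => (z - p)^-1) m p t).
Proof.
move=> t0.
have sq (x : R) : 0 <= x <= 1 -> 2^-1 <= (1 + x ^+ 2)^-1.
  by move=> x01; rewrite lef_pV2 ?posrE; nra.
have E1 : 2^-1 <= complex.Im (edge_sum R (fun z => (z - p)^-1) m (p + t) ('i * t)).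
  apply: edge_sum_ImP => z [x x01 ->].
  have -> : p + t + x%:C * ('i * t) - p = (1 +i* x)%C * t.
    by rewrite cartesianE rmorph1; ring.
  rewrite invfM mulrACA mulVf// mulr1 /=.
  rewrite mulr0 addr0 mulr1 mul1r expr1n; exact: sq.
have E2 : 2^-1 <= complex.Im (edge_sum R (fun z => - 1 * (z - p)^-1) m (p + 'i * t) t).
  apply: edge_sum_ImP => z [x x01 ->].
  have -> : p + 'i * t + x%:C * t - p = (x +i* 1)%C * t.
    by rewrite cartesianE rmorph1; ring.
  rewrite invfM -!mulrA mulVf// mulr1 mulN1r /= opprK.
  rewrite expr1n addrC mul1r; exact: sq.
rewrite edge_sumZ mulN1r in E2; move: E1 E2; rewrite /outer.
case: (edge_sum _ _ _ _ _) => ? ?; case: (edge_sum _ _ _ _ _) => ? ? /=; lra.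
Qed.

(** A weak Cauchy formula. The difference quotient of [f] at [p] is bounded near [p], so its sums
    over the four squares around [p] tend to 0. Hence [f p] times the winding sum, of modulus at
    least 4, is close to the outer sum of [f z / (z - p)], of modulus at most [8 * M]. *)
Lemma cauchy_bound (f : C -> C) p t (M : R) : t != 0 ->
  (forall z, normc (z - p) <= 2 * normc t -> holo_at R f z) ->
  (forall z, normc t <= normc (z - p) <= 2 * normc t -> normc (f z) <= M) ->
  normc (f p) <= 2 * M.
Proof.
move=> t0 df fM.
have i0 : 'i%C != 0 :> C by rewrite -normc_gt0 normc_i.
(* The difference form lets linearity of [edge_sum] split off [f p] times the winding sum. *)
pose h z := f z * (z - p)^-1 - f p * (z - p)^-1.
have hE z : h z = (f z - f p) / (z - p) by rewrite /h mulrBl.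
have dh t' z : normc t' = normc t -> in_square R p t' z -> z != p ->
    holo_at R h z.
  move=> tt' /(in_square_dist _ _ _ _ _ (in_square_corner _ _ _)).
  rewrite tt' => /df dfz zp.
  have inv : holo_at R (fun w => (w - p)^-1) z.
    apply: holoV; first by rewrite subr_eq0.
    by apply: holoB; [exact: holo_id|exact: holo_cst].
  exact: (holoB _ _ _ _ (holoM _ _ _ _ dfz inv) (holoM _ _ _ _ (holo_cst _ (f
    p) z) inv)).
have [d d0 hM] : exists2 d : R, 0 < d & exists M', forall z, normc (z - p) < d ->
    normc (h z) <= M'.
  have [|l Hl] := @holo_normc R f p.
    by apply: df; rewrite subrr normc0 mulr_ge0 ?normc_ge0.
  have [d d0 Hd] := Hl 1 ltr01.
  exists d => //; exists (1 + normc l) => z zd; rewrite hE.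
  have [->|zp] := eqVneq z p.
    by rewrite !subrr mul0r normc0 addr_ge0 ?normc_ge0.
  have zp0 : 0 < normc (z - p) by rewrite normc_gt0 subr_eq0.
  rewrite normcM normcV ler_pdivrMr//.
  have := Hd _ zd; rewrite (addrC p) subrK => H.
  have -> : f z - f p = (f z - f p - l * (z - p)) + l * (z - p) by ring.
  by rewrite (le_trans (normc_triangle _ _ _))// normcM; lra.
case: hM => M' hM'.
have small t' : normc t' = normc t -> forall e : R, 0 < e ->
    exists n, forall m, (n <= m)%N -> normc (square_sum R h m p t') <= e.
  move=> tt'; apply: (@goursat_corner R h p t' d M') => // z; exact: dh.
have nit : normc ('i * t) = normc t by rewrite normcM normc_i mul1r.
suff H (e : R) : 0 < e -> 4 * normc (f p) <= 4 * e + 8 * M.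
  rewrite leNgt; apply/negP => fp.
  have := H ((normc (f p) - 2 * M) / 2); lra.
move=> e0.
have [n1 H1] := small t erefl e e0.
have [n2 H2] := small ('i * t) nit e e0.
have [n3 H3] := small (- t) (normc_opp R t) e e0.
have [n4 H4] := small (- ('i * t)) (etrans (normc_opp R _) nit) e e0.
pose m := maxn (maxn n1 n2) (maxn n3 n4).
have : (m <= m)%N by []; rewrite {1}/m !geq_max.
case/andP => /andP[/H1 {}H1 /H2 {}H2] /andP[/H3 {}H3 /H4 {}H4].
have outerE t' : outer h m p t' = outer (fun z => f z * (z - p)^-1) m p t' -
    f p * outer (fun z => (z - p)^-1) m p t'.
  by rewrite /outer /h !edge_sumB !edge_sumZ; ring.
have := outer_sum h m p t.
rewrite !outerE.
have tn : forall t', normc t' = normc t -> t' != 0 by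
  move=> t' tt'; rewrite -normc_gt0 tt' normc_gt0.
have fM' t' : normc t' = normc t -> normc (outer (fun z => f z * (z - p)^-1) m
  p t') <= 2 * M.
  by move=> tt'; apply: outer_bound; rewrite ?tt' ?tn.
have B1 := fM' t erefl; have B2 := fM' ('i * t) nit.
have B3 := fM' (- t) (normc_opp R t).
have B4 := fM' (- ('i * t)) (etrans (normc_opp R _) nit).
have I1 := outer_inv_Im m p _ (tn t erefl);
  have I2 := outer_inv_Im m p _ (tn ('i * t) nit).
have I3 := outer_inv_Im m p _ (tn (- t) (normc_opp R t)).
have I4 := outer_inv_Im m p _ (tn (- ('i * t)) (etrans (normc_opp R _) nit)).
move: H1 H2 H3 H4 B1 B2 B3 B4 I1 I2 I3 I4.
move: (square_sum _ _ _ _ _) (square_sum _ _ _ _ _) (square_sum _ _ _ _ _)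
  (square_sum _ _ _ _ _).
move: (outer _ _ _ _) (outer _ _ _ _) (outer _ _ _ _) (outer _ _ _ _).
move: (outer _ _ _ _) (outer _ _ _ _) (outer _ _ _ _) (outer _ _ _ _).
move=> I1 I2 I3 I4 b1 b2 b3 b4 s1 s2 s3 s4 H1 H2 H3 H4 B1 B2 B3 B4 J1 J2 J3 J4.
have : 4 <= normc (I1 + I2 + I3 + I4).
  apply: (le_trans _ (normc_Im _ _)); apply: (le_trans _ (ler_norm _)).
  by move: J1 J2 J3 J4; case: I1 I2 I3 I4 => ? ? [? ?] [? ?] [? ?] /=; lra.
move=> I4n E.
have /(congr1 (@normc R)) : f p * (I1 + I2 + I3 + I4) =
    b4 + b3 + b2 + b1 - (s4 + s3 + s2 + s1) by rewrite -E; ring.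
rewrite normcM => E'.
have := normc_triangleB _ (b4 + b3 + b2 + b1) (s4 + s3 + s2 + s1).
have := normc_triangle _ (b4 + b3 + b2) b1; have := normc_triangle _ (b4 + b3) b2.
have := normc_triangle _ b4 b3.
have := normc_triangle _ (s4 + s3 + s2) s1; have := normc_triangle _ (s4 + s3) s2.
have := normc_triangle _ s4 s3; have := normc_ge0 _ (f p).
nra.
Qed.

Lemma in_square_quarters a s z : in_square R a s z ->
  [\/ in_square R a (s / 2) z, in_square R (a + s / 2) (s / 2) z,
      in_square R (a + 'i * (s / 2)) (s / 2) z |
      in_square R (a + s / 2 + 'i * (s / 2)) (s / 2) z].
Proof.
move=> [x [y [x01 y01 ->]]].
have dbl (u : R) : (2 * u)%:C = 2 * u%:C :> C by rewrite rmorphM rmorph_nat.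
have dblB (u : R) : (2 * u - 1)%:C = 2 * u%:C - 1 :> C by rewrite rmorphB
  rmorph1 /= dbl.
have [x2|x2] := leP x 2^-1; have [y2|y2] := leP y 2^-1.
- by apply: Or41; exists (2 * x), (2 * y); split; [lra|lra|rewrite !dbl; field].
- by apply: Or43; exists (2 * x), (2 * y - 1); split; [lra|lra|rewrite dblB dbl; field].
- by apply: Or42; exists (2 * x - 1), (2 * y); split; [lra|lra|rewrite dblB dbl; field].
- by apply: Or44; exists (2 * x - 1), (2 * y - 1); split;
  [lra|lra|rewrite !dblB; field].
Qed.

(** An upper semicontinuous function attains its maximum on a closed disc. Otherwise every small
    square is beaten by a value of [u] at a single point of the disc; the best of four such points
    beats the four quarters together. By [square_induction] one point then beats a square containing
    the disc, hence itself. *)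
Lemma disc_max (u : C -> R) (r : R) : 0 <= r ->
  (forall z, normc z <= r -> forall e : R, 0 < e -> exists2 d : R, 0 < d &
     forall w, normc (w - z) < d -> u w < u z + e) ->
  exists2 p, normc p <= r & forall z, normc z <= r -> u z <= u p.
Proof.
move=> r0 usc; apply: contrapT => noM.
have nomax p : normc p <= r -> exists2 z, normc z <= r & u p < u z.
  move=> pr; apply: contrapT => H; apply: noM; exists p => // z zr.
  by rewrite leNgt; apply/negP => ?; apply: H; exists z.
pose P a s := exists2 p, normc p <= r &
  forall z, in_square R a s z -> normc z <= r -> u z < u p.
(* Adding 1 keeps the enclosing square nondegenerate when [r = 0]. *)
pose r' := r + 1.
have r'0 : 0 < 2 * r' by rewrite /r'; lra.
suff [p pr H] : P (- (r'%:C + 'i * r'%:C)) (2 * r')%:C.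
  suff /H /(_ pr) : in_square R (- (r'%:C + 'i * r'%:C)) (2 * r')%:C p by rewrite ltxx.
  have := normc_Im _ p; have := normc_Re _ p; rewrite !ler_norml.
  case: p pr {H} => x y /= xyr xr yr.
  have xr' : 0 <= x + r' <= 2 * r' by rewrite /r'; lra.
  have yr' : 0 <= y + r' <= 2 * r' by rewrite /r'; lra.
  exists ((x + r') / (2 * r')), ((y + r') / (2 * r')); split.
  - by rewrite ler_pdivrMr// mul1r ler_pdivlMr// mul0r.
  - by rewrite ler_pdivrMr// mul1r ler_pdivlMr// mul0r.
  - rewrite mulrDl -mulrA -!rmorphM /= !mulfVK ?gt_eqF// cartesianE !rmorphD /=.
    by ring.
apply: square_induction => [a s|z _].
  have best p q : normc p <= r -> normc q <= r ->
      exists p', [/\ normc p' <= r, u p <= u p' & u q <= u p'].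
    by move=> pr qr; have [pq|/ltW qp] := leP (u p) (u q); [exists q|exists p].
  move=> [p1 r1 H1] [p2 r2 H2] [p3 r3 H3] [p4 r4 H4].
  have [p5 [r5 H15 H25]] := best _ _ r1 r2; have [p6 [r6 H36 H46]] := best _ _ r3 r4.
  have [p [pr H5 H6]] := best _ _ r5 r6; exists p => // z.
  case/in_square_quarters => zs zr.
  - exact: lt_le_trans (H1 _ zs zr) (le_trans H15 H5).
  - exact: lt_le_trans (H2 _ zs zr) (le_trans H25 H5).
  - exact: lt_le_trans (H3 _ zs zr) (le_trans H36 H6).
  - exact: lt_le_trans (H4 _ zs zr) (le_trans H46 H6).
have [zr|rz] := leP (normc z) r.
  have [p pr zp] := nomax z zr.
  have [|d d0 Hd] := usc z zr (u p - u z); first by rewrite subr_gt0.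
  exists (d / 2) => [|a s az _ sd]; first lra.
  exists p => // w aw _; have := Hd w; rewrite addrCA subrr addr0; apply.
  by have := in_square_dist _ _ _ _ _ az aw; lra.
exists ((normc z - r) / 2) => [|a s az _ sd]; first lra.
exists 0; first by rewrite normc0.
move=> w aw wr; exfalso.
have := in_square_dist _ _ _ _ _ az aw.
have -> : w - z = - (z - w) by ring.
rewrite normc_opp; have := normc_triangle _ (z - w) w; rewrite subrK; lra.
Qed.

(** The weight [1 + c * normc z ^+ 2], normalised at [p], dominates the squared modulus of an affine
    holomorphic factor, with a gap quadratic in the distance to [p]. *)
Lemma normc_sqr_tangent (c : R) p z : 0 <= c ->
  let A := 1 + c * normc p ^+ 2 in
  normc (1 + (c / A)%:C * p^* * (z - p)) ^+ 2 =
  (1 + c * normc z ^+ 2) / A - c / A / A * normc (z - p) ^+ 2.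
Proof.
move=> c0 A; have : A != 0.
  by rewrite gt_eqF// ltr_pwDl// mulr_ge0// sqr_ge0.
rewrite /A !normc_sqr; case: z p {A} => z' z'' [p' p''] /= A0.
by field.
Qed.

(** At [z1] only continuity and a zero are required, which avoids removing a singularity in the
    application: the maximum point found in the proof has [g p != 0], so it is not [z1], and the
    argument is local around it. *)
Lemma maximum_principle (g : C -> C) z1 (r B : R) : 0 <= r -> 0 <= B ->
  (forall z, normc z <= r -> z != z1 -> holo_at R g z) ->
  g z1 = 0 ->
  (forall e : R, 0 < e -> exists2 d : R, 0 < d &
     forall w, normc (w - z1) < d -> normc (g w - g z1) < e) ->
  (forall z, normc z = r -> normc (g z) <= B) ->
  forall z, normc z <= r -> normc (g z) <= B.
Proof.
move=> r0 B0 dg gz1 cg gB z0 z0r; rewrite leNgt; apply/negP => Bz0.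
have cont z : normc z <= r -> forall e : R, 0 < e -> exists2 d : R, 0 < d &
    forall w, normc (w - z) < d -> normc (g w - g z) < e.
  move=> zr; have [->//|zz1] := eqVneq z z1.
  by apply: holo_continuous; exact: dg.
pose D := normc (g z0) ^+ 2 - B ^+ 2.
have D0 : 0 < D by rewrite subr_gt0 ltrXn2r// ?nnegrE ?normc_ge0.
(* Small enough that the weight [1 + c * r ^+ 2] on the boundary cannot make up for the gap between
   [B] and [normc (g z0)]. *)
pose c := D / (B ^+ 2 * r ^+ 2 + 1).
have K0 : 0 < B ^+ 2 * r ^+ 2 + 1 by rewrite ltr_wpDl// mulr_ge0 ?sqr_ge0.
have c0 : 0 < c by exact: divr_gt0.
have cB : B ^+ 2 * (1 + c * r ^+ 2) < normc (g z0) ^+ 2.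
  have : c * (B ^+ 2 * r ^+ 2 + 1) = D by rewrite mulfVK// gt_eqF.
  rewrite /D; nra.
(* Maximising [u] instead of [normc \o g] makes the maximum at [p] strict once
   [g] is multiplied by the holomorphic factor [1 + c / A * p^* * (z - p)], and the
   [n]-th powers then contradict [cauchy_bound]. *)
pose u z := normc (g z) ^+ 2 * (1 + c * normc z ^+ 2).
have usc z : normc z <= r -> forall e : R, 0 < e -> exists2 d : R, 0 < d &
     forall w, normc (w - z) < d -> u w < u z + e.
  move=> zr e e0.
  (* [X] and [Y] are the factors of [u z]; for [h <= 1] they grow by at most [h * x] and [h * y], so
     their product grows by at most [h * K]. *)
  pose X := normc (g z) ^+ 2; pose x := 2 * normc (g z) + 1.
  pose Y := 1 + c * normc z ^+ 2; pose y := c * (2 * normc z + 1).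
  have gz0 := normc_ge0 _ (g z); have nz0 := normc_ge0 _ z.
  have X0 : 0 <= X by exact: sqr_ge0.
  have x0 : 0 <= x by rewrite /x; lra.
  have Y0 : 0 <= Y by rewrite addr_ge0// mulr_ge0 ?sqr_ge0// ltW.
  have y0 : 0 <= y by rewrite mulr_ge0 ?(ltW c0)//; lra.
  pose K := x * Y + X * y + x * y.
  have KK : 0 <= K by rewrite /K !addr_ge0// mulr_ge0.
  pose h := Num.min 1 (e / (K + 1)).
  have h0 : 0 < h by rewrite lt_min ltr01 divr_gt0// ltr_wpDl.
  have h1 : h <= 1 by rewrite ge_min lexx.
  have hK : h * (K + 1) <= e by rewrite -ler_pdivlMr ?ltr_wpDl// ge_min lexx orbT.
  have [d d0 Hd] := cont z zr h h0.
  exists (Num.min d h) => [|w]; first by rewrite lt_min d0.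
  rewrite lt_min => /andP[/Hd gw wh].
  have gw' : normc (g w) <= normc (g z) + h.
    by have := normc_triangle _ (g w - g z) (g z); rewrite subrK; lra.
  have w' : normc w <= normc z + h.
    by have := normc_triangle _ (w - z) z; rewrite subrK; lra.
  have gw0 := normc_ge0 _ (g w); have w0 := normc_ge0 _ w.
  have Xw : normc (g w) ^+ 2 <= X + h * x by rewrite /X /x; nra.
  have Yw' : normc w ^+ 2 <= normc z ^+ 2 + h * (2 * normc z + 1) by nra.
  have Yw : 1 + c * normc w ^+ 2 <= Y + h * y by rewrite /Y /y; nra.
  have : u w <= (X + h * x) * (Y + h * y).
    by rewrite ler_pM ?sqr_ge0// addr_ge0// mulr_ge0 ?sqr_ge0// ltW.
  have -> : u z = X * Y by [].
  have : h * h * (x * y) <= h * (x * y).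
    by apply: ler_wpM2r; [exact: mulr_ge0|nra].
  move: hK h0; rewrite /K; clearbody X x Y y h; clear; lra.
have [p pr pmax] := disc_max u r r0 usc.
have c0' : 0 <= c by exact: ltW.
have up : normc (g z0) ^+ 2 <= u p.
  apply: le_trans (pmax _ z0r);
    rewrite /u ler_peMr ?sqr_ge0// lerDl mulr_ge0 ?sqr_ge0//.
have {}pr : normc p < r.
  rewrite lt_neqAle pr andbT; apply/eqP => pr'.
  have : normc (g p) ^+ 2 <= B ^+ 2 by rewrite lerXn2r ?nnegrE ?normc_ge0 ?gB.
  have : 0 <= 1 + c * r ^+ 2 by rewrite addr_ge0// mulr_ge0// sqr_ge0.
  by move: up; rewrite /u pr'; nra.
have gp : 0 < normc (g p).
  rewrite normc_gt0; apply/eqP => gp0; move: up; rewrite /u gp0 normc0 expr0n mul0r.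
  by have := sqr_ge0 B; move: D0; rewrite /D; lra.
have pz1 : p != z1 by apply: contraTneq gp => ->; rewrite gz1 normc0 ltxx.
have pz1' : 0 < normc (p - z1) by rewrite normc_gt0 subr_eq0.
(* The disc of radius [2 * T] about [p] stays in the disc of radius [r] and avoids [z1]. *)
pose T := Num.min ((r - normc p) / 2) (normc (p - z1) / 4).
have T0 : 0 < T by rewrite lt_min !divr_gt0// subr_gt0.
have T1 : 2 * T <= r - normc p.
  have : T <= (r - normc p) / 2 by rewrite ge_min lexx.
  lra.
have T2 : 2 * T < normc (p - z1).
  have : T <= normc (p - z1) / 4 by rewrite ge_min lexx orbT.
  lra.
pose A := 1 + c * normc p ^+ 2.
have A1 : 1 <= A by rewrite lerDl mulr_ge0// sqr_ge0.
have A0 : 0 < A by exact: lt_le_trans A1.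
pose G z := g z * (1 + (c / A)%:C * p^* * (z - p)).
pose k := c / A / A.
have k0 : 0 < k by rewrite !divr_gt0.
pose L1 := 1 + c * r ^+ 2.
have L10 : 0 < L1 by rewrite ltr_pwDl// mulr_ge0// sqr_ge0.
(* The gain on the annulus: the quadratic gap is at least [k * T ^+ 2] there, against a normalised
   weight of at most [L1]. *)
pose x := 1 + k * T ^+ 2 / L1.
have x1 : 1 < x by rewrite ltrDl divr_gt0// mulr_gt0// exprn_gt0.
have in_disc z : normc (z - p) <= 2 * T -> normc z <= r.
  by move=> zp; have := normc_triangle _ (z - p) p; rewrite subrK; lra.
have dG z : normc (z - p) <= 2 * T -> holo_at R G z.
  move=> zp; have dgz : holo_at R g z.
    apply: dg; first exact: in_disc.
    by apply: contraTneq zp => ->; rewrite -ltNge normc_subC.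
  have dl : holo_at R (fun z => z - p) z := holoB _ _ _ _ (holo_id _ z)
    (holo_cst _ p z).
  have da := holoM _ _ _ _ (holo_cst _ ((c / A)%:C * p^*) z) dl.
  exact: (holoM _ _ _ _ dgz (holoD _ _ _ _ (holo_cst _ 1 z) da)).
have Gx z : T <= normc (z - p) <= 2 * T -> normc (G z) ^+ 2 * x <= normc (g p) ^+ 2.
  move=> /andP[Tz zT].
  have zr := in_disc _ zT.
  pose L := (1 + c * normc z ^+ 2) / A.
  have gL : normc (g z) ^+ 2 * L <= normc (g p) ^+ 2.
    rewrite /L mulrA ler_pdivrMr//; exact: pmax.
  have LL1 : L <= L1.
    rewrite /L ler_pdivrMr//; apply: (@le_trans _ _ L1).
      by rewrite lerD2l ler_wpM2l// lerXn2r ?nnegrE ?normc_ge0.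
    by rewrite ler_peMr// ltW.
  have W : normc (1 + (c / A)%:C * p^* * (z - p)) ^+ 2 = L - k * normc (z - p) ^+ 2.
    exact: normc_sqr_tangent.
  rewrite /G normcM exprMn W.
  have TT : T ^+ 2 <= normc (z - p) ^+ 2 by rewrite lerXn2r ?nnegrE ?normc_ge0// ltW.
  apply: le_trans gL; rewrite -mulrA ler_wpM2l ?sqr_ge0//.
  have xL : (x - 1) * L1 = k * T ^+ 2 by rewrite /x addrC addKr mulfVK// gt_eqF.
  have : 0 <= k * normc (z - p) ^+ 2 by rewrite mulr_ge0 ?sqr_ge0// ltW.
  nra.
have TC : T%:C != 0 :> C by rewrite -normc_gt0 normc_real gtr0_norm.
have nT : normc (T%:C : C) = T by rewrite normc_real gtr0_norm.
(* [cauchy_bound] for the power [2 * n] of [G] loses only a factor 2, while the annulus gains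
   [x ^+ n]; the even exponent fits estimates made on squared moduli. *)
have [n] := exprn_unbounded R x 2 x1; apply/negP; rewrite -leNgt.
have := cauchy_bound (fun z => G z ^+ (2 * n)) p T%:C ((normc (g p) ^+ 2) ^+ n
  / x ^+ n) TC.
have xn : 0 < x ^+ n by rewrite exprn_gt0// (lt_trans ltr01).
have gn : 0 < (normc (g p) ^+ 2) ^+ n by rewrite !exprn_gt0.
have -> : normc (G p ^+ (2 * n)) = (normc (g p) ^+ 2) ^+ n.
  by rewrite /G subrr mulr0 addr0 mulr1 normcX exprM.
rewrite nT mulrA ler_pdivlMr// [_ * x ^+ n]mulrC ler_pM2r//; apply.
  by move=> z zT; apply: holoX; exact: dG.
move=> z zT; rewrite ler_pdivlMr// normcX exprM -exprMn lerXn2r ?nnegrE ?sqr_ge0//.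
  by rewrite mulr_ge0 ?sqr_ge0// ltW// (lt_trans ltr01).
exact: Gx.
Qed.

End MaximumPrinciple.

(** * Matrix-valued functions and spectra *)

Section FunctionAlgebra.
Variables (X : Type) (T : comNzRingType).

(** Determinants, adjugates, powers and characteristic coefficients are polynomial in the entries.
    One set of closure lemmas therefore serves both holomorphy at a point and boundedness near a
    point. *)
Definition fun_alg (S : (X -> T) -> Prop) := [/\ forall c, S (fun=> c),
  forall f g, S f -> S g -> S (fun z => f z + g z) &
  forall f g, S f -> S g -> S (fun z => f z * g z)].

Variables (S : (X -> T) -> Prop) (Salg : fun_alg S).

Lemma fun_alg_eq f g : f =1 g -> S f -> S g.
Proof. by move=> /funext->. Qed.

Lemma fun_alg_sum (I : Type) (r : seq I) (P : pred I) (f : I -> X -> T) :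
  (forall i, S (f i)) -> S (fun z => \sum_(i <- r | P i) f i z).
Proof.
case: Salg => Sc SD SM Sf; elim: r => [|i r IH].
  by apply: fun_alg_eq (Sc 0) => z; rewrite big_nil.
have [Pi|/negPf Pi] := boolP (P i).
  by apply: fun_alg_eq (SD _ _ (Sf i) IH) => z; rewrite big_cons Pi.
by apply: fun_alg_eq IH => z; rewrite big_cons Pi.
Qed.

Lemma fun_alg_prod (I : Type) (r : seq I) (P : pred I) (f : I -> X -> T) :
  (forall i, S (f i)) -> S (fun z => \prod_(i <- r | P i) f i z).
Proof.
case: Salg => Sc SD SM Sf; elim: r => [|i r IH].
  by apply: fun_alg_eq (Sc 1) => z; rewrite big_nil.
have [Pi|/negPf Pi] := boolP (P i).
  by apply: fun_alg_eq (SM _ _ (Sf i) IH) => z; rewrite big_cons Pi.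
by apply: fun_alg_eq IH => z; rewrite big_cons Pi.
Qed.

Definition mx_alg m n (M : X -> 'M[T]_(m, n)) := forall i j, S (fun z => M z i j).

Lemma mx_alg_det n (M : X -> 'M[T]_n) : mx_alg _ _ M -> S (fun z => \det (M z)).
Proof.
case: Salg => Sc SD SM SM'; apply: fun_alg_sum => s.
by apply: SM; [exact: Sc|exact: fun_alg_prod].
Qed.

Lemma mx_alg_adj n (M : X -> 'M[T]_n) :
  mx_alg _ _ M -> mx_alg _ _ (fun z => \adj (M z)).
Proof.
case: Salg => Sc SD SM SM' i j.
have := mx_alg_det _ (fun z => row' j (col' i (M z))).
move=> H; have {}H : S (fun z => \det (row' j (col' i (M z)))).
  by apply: H => k l; apply: fun_alg_eq (SM' (lift j k) (lift i l)) => z; rewrite !mxE.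
by apply: fun_alg_eq (SM _ _ (Sc ((-1) ^+ (j + i))) H) => z; rewrite !mxE.
Qed.

Lemma mx_algM m n p (M : X -> 'M[T]_(m, n)) (N : X -> 'M[T]_(n, p)) :
  mx_alg _ _ M -> mx_alg _ _ N -> mx_alg _ _ (fun z => M z *m N z).
Proof.
case: Salg => Sc SD SM SM' SN i j.
have := fun_alg_sum _ (index_enum 'I_n) xpredT (fun k z => M z i k * N z k j).
move=> H; have {}H := H (fun k => SM _ _ (SM' i k) (SN k j)).
by apply: fun_alg_eq H => z; rewrite !mxE.
Qed.

Lemma mx_algZ m n (f : X -> T) (M : X -> 'M[T]_(m, n)) :
  S f -> mx_alg _ _ M -> mx_alg _ _ (fun z => f z *: M z).
Proof.
case: Salg => Sc SD SM Sf SM' i j.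
by apply: fun_alg_eq (SM _ _ Sf (SM' i j)) => z; rewrite mxE.
Qed.

Lemma mx_algX n k (M : X -> 'M[T]_n.+1) :
  mx_alg _ _ M -> mx_alg _ _ (fun z => M z ^+ k).
Proof.
case: Salg => Sc SD SM SM'; elim: k => [|k IH] i j.
  by apply: fun_alg_eq (Sc ((i == j)%:R)) => z; rewrite expr0 mxE.
by apply: fun_alg_eq (mx_algM _ _ _ _ _ SM' IH i j) => z; rewrite exprS.
Qed.

Lemma mx_alg_horner n (M : X -> 'M[T]_n.+1) (p : {poly T}) :
  mx_alg _ _ M -> mx_alg _ _ (fun z => horner_mx (M z) p).
Proof.
case: Salg => Sc SD SM SM'; elim/poly_ind: p => [|p c IH] i j.
  by apply: fun_alg_eq (Sc 0) => z; rewrite rmorph0 mxE.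
have H := SD _ _ (mx_algM _ _ _ _ _ IH SM' i j) (Sc (c *+ (i == j))).
apply: fun_alg_eq H => z.
by rewrite rmorphD rmorphM /= horner_mx_X horner_mx_C !mxE.
Qed.

End FunctionAlgebra.

(** This allows [mx_alg_det] to be applied to the characteristic matrix, whose entries are
    polynomials. *)
Lemma fun_alg_poly (X : Type) (T : comNzRingType) (S : (X -> T) -> Prop) :
  fun_alg X T S ->
  fun_alg X {poly T} (fun f => forall k, S (fun z => (f z)`_k)).
Proof.
move=> Salg; case: (Salg) => Sc SD SM; split => [c k|f g Sf Sg k|f g Sf Sg k].
- exact: Sc.
- by apply: fun_alg_eq (SD _ _ (Sf k) (Sg k)) => z; rewrite coefD.
- have := fun_alg_sum _ _ _ Salg _ (index_enum 'I_k.+1) xpredT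
    (fun (i : 'I_k.+1) z => (f z)`_i * (g z)`_(k - i)).
  move=> H; have {}H := H (fun i => SM _ _ (Sf i) (Sg (k - i)%N)).
  by apply: fun_alg_eq H => z; rewrite coefM.
Qed.

Lemma mx_alg_char_poly (X : Type) (T : comNzRingType) (S : (X -> T) -> Prop) n
    (M : X -> 'M[T]_n) k : fun_alg X T S -> mx_alg X T S _ _ M ->
  S (fun z => (char_poly (M z))`_k).
Proof.
move=> Salg SM; have Spoly := fun_alg_poly _ _ _ Salg.
apply: (mx_alg_det _ _ _ Spoly _ (fun z => char_poly_mx (M z))) => i j l.
case: Salg => Sc SD SMul.
have H := SD _ _ (Sc (('X *+ (i == j))`_l)) (SMul _ _ (Sc (- (l == 0%N)%:R)) (SM i j)).
apply: fun_alg_eq H => z; rewrite !mxE coefB coefC mulNr.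
by case: (l == 0%N); rewrite ?mul1r ?mul0r.
Qed.

Section Spectra.
Variables (K : closedFieldType) (n : nat).
Implicit Types (W : 'M[K]_n.+1) (v : 'rV[K]_n.+1).

Lemma eigenvector_horner W v a (p : {poly K}) :
  v *m W = a *: v -> v *m horner_mx W p = p.[a] *: v.
Proof.
move=> vW; elim/poly_ind: p => [|p c IH].
  by rewrite rmorph0 mulmx0 horner0 scale0r.
rewrite rmorphD rmorphM /= horner_mx_X horner_mx_C mulmxDr mulmxA IH.
by rewrite -scalemxAl vW scalerA mul_mx_scalar -scalerDl hornerMXaddC.
Qed.

Lemma eigenvector_exp W v a k : v *m W = a *: v -> v *m W ^+ k = a ^+ k *: v.
Proof.
move=> /(eigenvector_horner _ _ _ 'X^k).
by rewrite rmorphXn /= horner_mx_X hornerXn.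
Qed.

Lemma exists_eigenvalue W : exists a, eigenvalue W a.
Proof.
have /closed_rootP[a aW] : size (char_poly W) != 1%N by rewrite size_char_poly.
by exists a; rewrite eigenvalue_root_char.
Qed.

(** Apply the linear factors of [p] to [v] one at a time: the first that kills the current nonzero
    vector exhibits it as an eigenvector. *)
Lemma singular_horner W v (p : {poly K}) : v != 0 -> v *m horner_mx W p = 0 ->
  exists2 a, eigenvalue W a & root p a.
Proof.
have [->|p0] := eqVneq p 0.
  by have [a aW] := exists_eigenvalue W; exists a; rewrite // root0.
have [s pE] := closed_field_poly_normal p.
have rp a : root p a = (a \in s) by rewrite pE rootZ ?lead_coef_eq0// root_prod_XsubC.
rewrite [in horner_mx _ _]pE linearZ /= -scalemxAr => v0 /eqP.
rewrite scaler_eq0 lead_coef_eq0 (negPf p0) /= => /eqP vs.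
suff [a aW as_] : exists2 a, eigenvalue W a & a \in s by exists a; rewrite ?rp.
elim: s v v0 vs {pE rp} => [|b s IH] v v0.
  by rewrite big_nil rmorph1 mulmx1 => v00; rewrite v00 eqxx in v0.
rewrite big_cons rmorphM /= mulmxA => vs.
have [vb|vb] := eqVneq (v *m horner_mx W ('X - b%:P)) 0.
  exists b; last exact: mem_head.
  apply/eigenvalueP; exists v => //; apply/eqP; rewrite -subr_eq0.
  by move: vb; rewrite rmorphB /= horner_mx_X horner_mx_C mulmxBr mul_mx_scalar => ->.
have [a aW as_] := IH _ vb vs.
by exists a => //; rewrite in_cons as_ orbT.
Qed.

Lemma eigenvalue_exp W k y : eigenvalue (W ^+ k) y ->
  exists2 a, eigenvalue W a & y = a ^+ k.
Proof.
move=> /eigenvalueP[v vW v0].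
have [|a aW] := singular_horner W v ('X^k - y%:P) v0.
  rewrite rmorphB rmorphXn /= horner_mx_X horner_mx_C mulmxBr vW.
  by rewrite mul_mx_scalar subrr.
by rewrite /root !hornerE subr_eq0 => /eqP <-; exists a.
Qed.

End Spectra.

(** * Bounds between the roots and the coefficients of a polynomial *)

Section PolynomialBounds.
Variable R : realType.
Local Notation C := R[i].

Lemma normc_sum (I : Type) (r : seq I) (P : pred I) (f : I -> C) :
  normc (\sum_(i <- r | P i) f i) <= \sum_(i <- r | P i) normc (f i).
Proof.
elim/big_ind2: _ => [|x a y b xa yb|//]; first by rewrite normc0.
by rewrite (le_trans (normc_triangle _ _ _))// lerD.
Qed.

Lemma normc_prod (I : Type) (r : seq I) (f : I -> C) :
  normc (\prod_(i <- r) f i) = \prod_(i <- r) normc (f i).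
Proof. by apply: (big_morph (@normc R)); [exact: normcM|exact: normc1]. Qed.

(** Each linear factor multiplies a uniform bound on the coefficients by at most [1 + b]. *)
Lemma coef_prod_bound (s : seq C) (b : R) j : 0 <= b ->
  (forall y, y \in s -> normc y <= b) ->
  normc ((\prod_(y <- s) ('X - y%:P))`_j) <= (1 + b) ^+ size s.
Proof.
move=> b0; elim: s j => [|y s IH] j sb.
  by rewrite big_nil coef1 expr0; case: eqP => _; rewrite ?normc1 ?normc0.
have {}IH j' := IH j' (fun x xs => sb x (mem_behead (s := y :: s) xs)).
have yb : normc y <= b by rewrite sb// mem_head.
rewrite big_cons mulrBl coefB coefXM coefCM /= exprS mulrDl mul1r.
rewrite (le_trans (normc_triangleB _ _ _))// lerD//.
  by case: eqP => _ //; rewrite normc0 exprn_ge0// addr_ge0.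
by rewrite normcM ler_pM ?normc_ge0.
Qed.

(** If [normc y >= 1], the lower terms at a root are together at most [N%:R * K * normc y ^+ N.-1],
    and they must balance the leading term. *)
Lemma root_bound (p : {poly C}) (N : nat) (K : R) y : p \is monic ->
  size p = N.+1 -> (forall j, normc p`_j <= K) -> root p y ->
  normc y <= 1 + N%:R * K.
Proof.
move=> pm ps pK /rootP py.
have K0 : 0 <= K := le_trans (normc_ge0 _ _) (pK 0%N).
rewrite leNgt; apply/negP => yb.
have NK0 : 0 <= N%:R * K by rewrite mulr_ge0.
have y1 : 1 <= normc y by lra.
case: N ps NK0 yb => [|N] ps NK0 yb.
  move: py; rewrite horner_coef ps big_ord1 expr0 mulr1 => /eqP.
  by move: pm; rewrite monicE lead_coefE ps => /eqP ->; rewrite oner_eq0.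
move: py; rewrite horner_coef ps big_ord_recr /=.
have -> : p`_N.+1 = 1 by move: pm; rewrite monicE lead_coefE ps => /eqP.
rewrite mul1r addrC => /eqP; rewrite addr_eq0 => /eqP /(congr1 (@normc R)).
rewrite normc_opp normcX => E.
have : normc y ^+ N.+1 <= N.+1%:R * K * normc y ^+ N.
  rewrite E (le_trans (normc_sum _ _ _ _))//.
  have -> : N.+1%:R * K * normc y ^+ N = \sum_(i < N.+1) K * normc y ^+ N.
    by rewrite sumr_const card_ord -mulrA mulr_natl.
  apply: ler_sum => i _;
    rewrite normcM normcX ler_pM ?normc_ge0 ?exprn_ge0 ?normc_ge0//.
  by rewrite ler_weXn2l// -ltnS.
rewrite exprS ler_pM2r ?exprn_gt0//; lra.
Qed.

End PolynomialBounds.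

(** * A Schwarz lemma for spectra *)

Section Mobius.
Variable R : realType.
Local Notation C := R[i].
Implicit Types (a z : C).

Lemma mobius_den a z : normc a < 1 -> normc z < 1 -> 1 - a^* * z != 0.
Proof.
move=> a1 z1; rewrite subr_eq0; apply/eqP => /(congr1 (@normc R)).
rewrite normcM normc_conj normc1.
have := normc_ge0 _ a; have := normc_ge0 _ z; nra.
Qed.

Lemma mobius_identity a z : normc (1 - a^* * z) ^+ 2 =
  normc (z - a) ^+ 2 + (1 - normc z ^+ 2) * (1 - normc a ^+ 2).
Proof. by rewrite !normc_sqr; case: a z => x y [u v] /=; ring. Qed.

Lemma mobius_dist_sqr a z :
  mobius_dist z a ^+ 2 = normc (z - a) ^+ 2 / normc (1 - a^* * z) ^+ 2.
Proof. by rewrite /mobius_dist normcM normcV expr_div_n. Qed.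

Lemma mobius_dist_ge0 a z : 0 <= mobius_dist z a.
Proof. exact: normc_ge0. Qed.

Lemma mobius_dist_le1 a z : normc a < 1 -> normc z < 1 -> mobius_dist z a <= 1.
Proof.
move=> a1 z1; have den := mobius_den _ _ a1 z1.
rewrite -(@ler_pXn2r _ 2)// ?nnegrE ?mobius_dist_ge0// expr1n mobius_dist_sqr.
rewrite ler_pdivrMr ?exprn_gt0 ?normc_gt0// mul1r mobius_identity lerDl.
by rewrite mulr_ge0// subr_ge0 exprn_ile1 ?normc_ge0// ltW.
Qed.

Lemma mobius_distC a z : mobius_dist z a = mobius_dist a z.
Proof.
have conj1 : (1 - a^* * z)^*%C = 1 - z^* * a.
  by rewrite rmorphB rmorphM rmorph1 /= conjcK mulrC.
by rewrite /mobius_dist !normcM !normcV normc_subC -conj1 normc_conj.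
Qed.

(** A quantitative form of the fact that the Moebius distance tends to 1 at the unit circle: in
    [mobius_identity] the defect is compared with the denominator, which is at least
    [(1 - normc a) ^+ 2] after squaring. *)
Lemma mobius_dist_boundary a z (e : R) : normc a < 1 -> normc z < 1 -> 0 <= e ->
  1 - normc z ^+ 2 <= e * (1 - normc a) ^+ 2 -> 1 - e <= mobius_dist z a ^+ 2.
Proof.
move=> a1 z1 e0 ze; have den := mobius_den _ _ a1 z1.
rewrite mobius_dist_sqr ler_pdivlMr ?exprn_gt0 ?normc_gt0//.
have a0 := normc_ge0 _ a; have z0 := normc_ge0 _ z.
have den1 : (1 - normc a) ^+ 2 <= normc (1 - a^* * z) ^+ 2.
  rewrite lerXn2r ?nnegrE ?normc_ge0 ?subr_ge0//; first exact: ltW.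
  have := normc_triangle _ (1 - a^* * z) (a^* * z).
  rewrite subrK normc1 normcM normc_conj; nra.
have : (1 - normc z ^+ 2) * (1 - normc a ^+ 2) <= e * (1 - normc a) ^+ 2.
  apply: le_trans ze; rewrite ler_piMr ?subr_ge0 ?exprn_ile1// ?(ltW z1)//.
  by rewrite lerBlDr lerDl sqr_ge0.
have := mobius_identity a z; nra.
Qed.

End Mobius.

(** * The Blaschke product of a matrix function and its eigenvalues *)

Section SchwarzForSpectra.
Variables (R : realType) (n : nat).
Local Notation C := R[i].
Variable F : C -> 'M[C]_n.+1.
Hypothesis F_holo : forall z, normc z < 1 -> forall i j, holo_at R (fun w => F w i j) z.
Hypothesis F_spec : forall z, normc z < 1 -> forall a, eigenvalue (F z) a ->
  normc a < 1.
Variables (z1 : C) (s : seq C).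
Hypothesis z1_disc : normc z1 < 1.
Hypothesis s_disc : forall a, a \in s -> normc a < 1.

(** In the application [s] lists the roots of the minimal polynomial of [F z1], with
    multiplicity. *)
Let P : {poly C} := \prod_(a <- s) ('X - a%:P).
Let Q : {poly C} := \prod_(a <- s) (1 - a^* *: 'X).
Hypothesis P_root : horner_mx (F z1) P = 0.

Let psi z := (z - z1) / (1 - z1^* * z).
Let QF z := horner_mx (F z) Q.
(* The Blaschke product [P / Q] evaluated at [F z]. *)
Let H z : 'M_n.+1 := (\det (QF z))^-1 *: (horner_mx (F z) P *m \adj (QF z)).
Let G z := (psi z)^-1 *: H z.

Lemma holo_alg z : fun_alg C C (fun f => holo_at R f z).
Proof. by split => [c|f g|f g]; [exact: holo_cst|exact: holoD|exact: holoM]. Qed.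

Lemma bounded_near_alg z : fun_alg C C (fun f => exists2 d : R, 0 < d &
  exists M : R, forall w, normc (w - z) < d -> normc (f w) <= M).
Proof.
split => [c|f g [d d0 [M fM]] [d' d'0 [M' gM]]|f g [d d0 [M fM]] [d' d'0 [M' gM]]].
- by exists 1 => //; exists (normc c).
- exists (Num.min d d'); first by rewrite lt_min d0.
  exists (M + M') => w; rewrite lt_min => /andP[/fM fw /gM gw].
  by rewrite (le_trans (normc_triangle _ _ _))// lerD.
- exists (Num.min d d'); first by rewrite lt_min d0.
  exists (M * M') => w; rewrite lt_min => /andP[/fM fw /gM gw].
  by rewrite normcM ler_pM ?normc_ge0.
Qed.

Lemma Q_neq0 b : normc b < 1 -> Q.[b] != 0.
Proof.
move=> b1; rewrite /Q horner_prod prodf_seq_neq0; apply/allP => a /s_disc a1.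
by rewrite !hornerE /= mobius_den.
Qed.

Lemma blaschke_eval b : P.[b] / Q.[b] = \prod_(a <- s) ((b - a) / (1 - a^* * b)).
Proof.
rewrite /P /Q !horner_prod -prodf_div; apply: eq_bigr => a _.
by rewrite !hornerE.
Qed.

Lemma blaschke_le1 b : normc b < 1 -> normc P.[b] <= normc Q.[b].
Proof.
move=> b1; rewrite -[leRHS]mul1r -ler_pdivrMr ?normc_gt0 ?Q_neq0//.
rewrite -normcV -normcM blaschke_eval normc_prod big_seq.
apply: prodr_ile1 => a /s_disc a1; rewrite normc_ge0 /=; exact: mobius_dist_le1.
Qed.

(** A singular [QF z] would give [Q] a root among the eigenvalues of [F z], but [Q] has no root in
    the disc. *)
Lemma det_QF z : normc z < 1 -> \det (QF z) != 0.
Proof.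
move=> zd; apply/det0P => -[v v0 vQ].
have [b bF /rootP Qb] := singular_horner _ _ _ _ _ v0 vQ.
by have := Q_neq0 b (F_spec z zd b bF); rewrite Qb eqxx.
Qed.

Lemma psi_neq0 z : normc z < 1 -> z != z1 -> psi z != 0.
Proof. by move=> zd zz1; rewrite mulf_neq0 ?invr_eq0 ?mobius_den// subr_eq0. Qed.

Lemma psi_holo z : normc z < 1 -> holo_at R psi z.
Proof.
move=> zd; have num := holoB _ _ _ _ (holo_id _ z) (holo_cst _ z1 z).
have den := holoB _ _ _ _ (holo_cst _ 1 z) (holoM _ _ _ _ (holo_cst _ z1^* z)
  (holo_id _ z)).
have dV := holoV _ (fun w => 1 - z1^* * w) z (mobius_den _ _ _ z1_disc zd) den.
exact: (holoM _ _ _ _ num dV).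
Qed.

Lemma H_holo z i j : normc z < 1 -> holo_at R (fun w => H w i j) z.
Proof.
move=> zd; have S := holo_alg z.
have SF : mx_alg C C (fun f => holo_at R f z) _ _ F by exact: F_holo.
have SQ := mx_alg_horner _ _ _ S _ _ Q SF.
have SP := mx_alg_horner _ _ _ S _ _ P SF.
have Sdet := holoV _ (fun w => \det (QF w)) z (det_QF _ zd) (mx_alg_det _ _ _ S _ _ SQ).
exact: (mx_algZ _ _ _ S _ _ _ _ Sdet (mx_algM _ _ _ S _ _ _ _ _ SP (mx_alg_adj
  _ _ _ S _ _ SQ))).
Qed.

Lemma H_z1 : H z1 = 0.
Proof. by rewrite /H P_root mul0mx scaler0. Qed.

Lemma G_holo z i j : normc z < 1 -> z != z1 -> holo_at R (fun w => G w i j) z.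
Proof.
move=> zd zz1; have S := holo_alg z.
have Sp := holoV _ psi z (psi_neq0 _ zd zz1) (psi_holo _ zd).
exact: (mx_algZ _ _ _ S _ _ _ _ Sp (fun i j => H_holo z i j zd)).
Qed.

(** The simple zero of [psi] at [z1] is compensated by the vanishing of [H] there. The constant 3
    bounds [1 - z1^* * w] when [normc w <= 2]. *)
Lemma G_bounded i j : exists2 d : R, 0 < d &
  exists M : R, forall w, normc (w - z1) < d -> normc (G w i j) <= M.
Proof.
have H0 : H z1 i j = 0 by rewrite H_z1 mxE.
have [d d0 [M [M0 HM]]] := holo_vanishing _ (fun w => H w i j) z1 (H_holo z1 i
  j z1_disc) H0.
exists (Num.min d 1); first by rewrite lt_min d0 ltr01.
exists (M * 3) => w; rewrite lt_min => /andP[/HM {}HM w1].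
have [->|wz1] := eqVneq w z1.
  by rewrite /G H_z1 scaler0 mxE normc0 mulr_ge0.
have wz0 : 0 < normc (w - z1) by rewrite normc_gt0 subr_eq0.
have psiM : normc (psi w)^-1 <= 3 / normc (w - z1).
  rewrite /psi invf_div normcM normcV ler_pM2r ?invr_gt0//.
  rewrite (le_trans (normc_triangleB _ _ _))// normc1 normcM normc_conj.
  have : normc w <= 2.
    by have := normc_triangle _ (w - z1) z1; rewrite subrK; move: z1_disc; lra.
  move=> w2; have : normc z1 * normc w <= 1 * 2 by rewrite ler_pM ?normc_ge0// ltW.
  lra.
rewrite /G mxE normcM mulrC.
have -> : M * 3 = (M * normc (w - z1)) * (3 / normc (w - z1)).
  by field; rewrite gt_eqF.
by rewrite ler_pM ?normc_ge0.
Qed.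

(** With [t = b * psi z], an eigenvector for [b] is killed by [P - t Q] evaluated at [F z]. So [t]
    is the value of the Blaschke product at some eigenvalue of [F z], and has modulus at most 1. *)
Lemma G_eigenvalue z b : normc z < 1 -> z != z1 -> eigenvalue (G z) b ->
  normc b * normc (psi z) <= 1.
Proof.
move=> zd zz1 /eigenvalueP[v vG v0].
pose t := b * psi z.
have vH : v *m H z = t *: v.
  have -> : H z = psi z *: G z by rewrite /G scalerA divff ?scale1r// psi_neq0.
  by rewrite -scalemxAr vG scalerA mulrC.
have HQ : H z *m QF z = horner_mx (F z) P.
  rewrite /H -scalemxAl -mulmxA mul_adj_mx mul_mx_scalar scalerA.
  by rewrite mulVf ?scale1r// det_QF.
have [|a aF /rootP] := singular_horner _ _ (F z) v (P - t *: Q) v0.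
  rewrite rmorphB /= linearZ /= mulmxBr -HQ mulmxA vH -scalemxAl -scalemxAr.
  by rewrite subrr.
have a1 := F_spec z zd a aF.
rewrite !hornerE => /eqP; rewrite subr_eq0 => /eqP E.
have := blaschke_le1 a a1; rewrite E normcM -[leRHS]mul1r ler_pM2r ?normc_gt0 ?Q_neq0//.
by rewrite normcM.
Qed.

(** The eigenvalues of [G z ^+ k] have modulus at most 2, so each of the [n.+1] linear factors of
    the characteristic polynomial contributes [1 + 2]. *)
Lemma G_coef_bound k j z : normc z < 1 -> z != z1 ->
  1 <= 2 * normc (psi z) ^+ k ->
  normc (char_poly (G z ^+ k))`_j <= 3 ^+ n.+1.
Proof.
move=> zd zz1 psik.
have [r rE] := closed_field_poly_normal (char_poly (G z ^+ k)).
move: (rE); rewrite (monicP (char_poly_monic _)) scale1r => rE1.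
have sr : size r = n.+1.
  by have := size_char_poly (G z ^+ k); rewrite rE1 size_prod_XsubC => -[].
rewrite rE1 -sr; have -> : 3 = 1 + 2 :> R by ring.
apply: coef_prod_bound => // y yr.
have : eigenvalue (G z ^+ k) y by rewrite eigenvalue_root_char rE1 root_prod_XsubC.
move=> /eigenvalue_exp[b /(G_eigenvalue z b zd zz1) bpsi ->].
rewrite normcX.
have b0 := normc_ge0 _ b; have p0 := normc_ge0 _ (psi z).
have : (normc b * normc (psi z)) ^+ k <= 1 by rewrite exprn_ile1// mulr_ge0.
have : 0 <= normc b ^+ k by rewrite exprn_ge0.
by rewrite exprMn; nra.
Qed.

Lemma schwarz_coef k j z : normc z < 1 -> z != z1 ->
  normc (psi z) * normc (char_poly (G z ^+ k))`_j <= 3 ^+ n.+1.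
Proof.
move=> zd zz1.
(* Chosen so that [k%:R * e <= 1/2]: by Bernoulli, [normc (psi w) ^+ 2 >= 1 - e] forces
   [normc (psi w) ^+ k >= 1/2], as [G_coef_bound] requires. *)
pose e : R := (2 * k.+1%:R)^-1.
have e0 : 0 < e by rewrite invr_gt0 mulr_gt0.
have ke : e * k%:R <= 2^-1.
  rewrite /e invfM -mulrA ler_piMr// ?invr_ge0// mulrC ler_pdivrMr// mul1r ler_nat.
  exact: leqnSn.
have e_half : e <= 2^-1 by rewrite lef_pV2 ?posrE ?mulr_gt0// ler_peMr// ler1n.
have e1 : e <= 1 by lra.
have bern m : 1 - m%:R * e <= (1 - e) ^+ m.
  elim: m => [|m IH]; first by rewrite expr0 mul0r subr0.
  have m0 : 0 <= m%:R * e * e by rewrite !mulr_ge0// ltW.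
  have := ler_wpM2r (_ : 0 <= 1 - e) IH; rewrite subr_ge0 => /(_ e1).
  by rewrite exprSr -natr1; apply: le_trans; lra.
have e2 : 0 < e * (1 - normc z1) ^+ 2 by rewrite mulr_gt0// exprn_gt0// subr_gt0.
(* The circle must enclose [z] and be close enough to the unit circle for [mobius_dist_boundary]. *)
pose r := Num.max (normc z) (1 - e * (1 - normc z1) ^+ 2 / 2).
have r1 : r < 1 by rewrite gt_max zd; lra.
have zr : normc z <= r by rewrite le_max lexx.
have r0 : 0 <= r by exact: le_trans (normc_ge0 _ z) zr.
have re : 1 - r ^+ 2 <= e * (1 - normc z1) ^+ 2.
  have : 1 - e * (1 - normc z1) ^+ 2 / 2 <= r by rewrite le_max lexx orbT.
  nra.
pose g w := psi w * (char_poly (G w ^+ k))`_j.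
rewrite -normcM -/(g z).
have psi1 : psi z1 = 0 by rewrite /psi subrr mul0r.
apply: (maximum_principle _ g z1 r) => //.
- exact: exprn_ge0.
- move=> w wr wz1; have wd : normc w < 1 by exact: le_lt_trans r1.
  have S := holo_alg w.
  have SG : mx_alg C C (fun f => holo_at R f w) _ _ G.
    by move=> a b; exact: G_holo.
  have Sc := mx_alg_char_poly _ _ _ _ _ j S (mx_algX _ _ _ S _ k _ SG).
  exact: (holoM _ _ _ _ (psi_holo _ wd) Sc).
- by rewrite /g psi1 mul0r.
(* Continuity at [z1]: the coefficient stays bounded there and [psi] tends to 0. *)
- move=> eps eps0.
  have Sc := mx_alg_char_poly _ _ _ _ _ j (bounded_near_alg z1)
     (mx_algX _ _ _ (bounded_near_alg z1) _ k _ G_bounded).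
  have [d d0 [M HM]] := Sc.
  have M0 : 0 <= M by apply: le_trans (HM z1 _); rewrite ?normc_ge0// subrr normc0.
  have [|d' d'0 Hd'] := holo_continuous _ _ _ (psi_holo _ z1_disc) (eps / (M + 1)).
    by rewrite divr_gt0// ltr_wpDl.
  exists (Num.min d d'); first by rewrite lt_min d0.
  move=> w; rewrite lt_min => /andP[/HM cw /Hd'].
  rewrite /g psi1 mul0r !subr0 ltr_pdivlMr ?ltr_wpDl// => pw.
  rewrite normcM; apply: le_lt_trans pw; rewrite ler_wpM2l ?normc_ge0//; lra.
- move=> w wr; have wd : normc w < 1 by rewrite wr.
  have psiw : 1 - e <= normc (psi w) ^+ 2.
    by apply: mobius_dist_boundary; rewrite ?wr// ltW.
  have psik : 2^-1 <= normc (psi w) ^+ k.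
    have h1 : 2^-1 <= (normc (psi w) ^+ k) ^+ 2.
      rewrite -exprM mulnC exprM; apply: (@le_trans _ _ ((1 - e) ^+ k)).
        by apply: le_trans (bern k); lra.
      by rewrite lerXn2r ?nnegrE ?sqr_ge0// subr_ge0.
    have := exprn_ge0 k (normc_ge0 _ (psi w)); nra.
  have wz1 : w != z1.
    apply: contraTneq psiw => ->; rewrite psi1 normc0 expr0n -ltNge /=.
    lra.
  rewrite /g normcM -[leRHS]mul1r ler_pM ?normc_ge0//.
    exact: mobius_dist_le1.
  by apply: G_coef_bound => //; lra.
Qed.

(** All powers of the ratio [x] of the two sides are moduli of roots of characteristic polynomials
    whose coefficients are bounded independently of [k]; hence [x <= 1]. *)
Lemma schwarz_blaschke z2 mu : normc z2 < 1 -> z2 != z1 -> eigenvalue (F z2) mu ->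
  \prod_(a <- s) mobius_dist mu a <= mobius_dist z2 z1.
Proof.
move=> zd zz1 muF.
have mud := F_spec _ zd _ muF.
have -> : \prod_(a <- s) mobius_dist mu a = normc (P.[mu] / Q.[mu]).
  by rewrite blaschke_eval normc_prod.
rewrite -[leRHS]/(normc (psi z2)).
have psi0 : 0 < normc (psi z2) by rewrite normc_gt0 psi_neq0.
pose x := normc (P.[mu] / Q.[mu]) / normc (psi z2).
pose K : R := 1 + n.+1%:R * (3 ^+ n.+1 / normc (psi z2)).
suff xK k : x ^+ k <= K.
  rewrite -[leRHS]mul1r -ler_pdivrMr// -/x leNgt;
    apply/negP => /exprn_unbounded - /(_ K)[k].
  by rewrite ltNge xK.
have /eigenvalueP[v vF v0] := muF.
(* An eigenvector of [F z2] is one of [QF z2], hence of its adjugate, since their product is the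
   scalar matrix of the determinant. *)
have vadj : v *m \adj (QF z2) = (\det (QF z2) / Q.[mu]) *: v.
  have := congr1 (mulmx v) (mul_mx_adj (QF z2)).
  rewrite mulmxA (eigenvector_horner _ _ _ _ _ Q vF) -scalemxAl mul_mx_scalar.
  move=> /(congr1 (fun u => Q.[mu]^-1 *: u)).
  by rewrite !scalerA mulVf ?Q_neq0// scale1r mulrC.
have vG : v *m G z2 = (P.[mu] / Q.[mu] / psi z2) *: v.
  rewrite /G /H -!scalemxAr mulmxA (eigenvector_horner _ _ _ _ _ P vF) -scalemxAl vadj.
  rewrite !scalerA; congr (_ *: _).
  by field; rewrite det_QF ?psi_neq0 ?Q_neq0.
have : eigenvalue (G z2 ^+ k) ((P.[mu] / Q.[mu] / psi z2) ^+ k).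
  by apply/eigenvalueP; exists v => //; exact: eigenvector_exp.
rewrite eigenvalue_root_char => rt.
have -> : x ^+ k = normc ((P.[mu] / Q.[mu] / psi z2) ^+ k).
  by rewrite normcX [in RHS]normcM normcV.
apply: root_bound (char_poly_monic _) (size_char_poly _) _ rt => j.
by rewrite ler_pdivlMr// mulrC; exact: schwarz_coef.
Qed.

End SchwarzForSpectra.

(** * The spectral unit ball *)

Section SpectralBall.
Variable R : realType.
Local Notation C := R[i].

Lemma spectral_unit_ballP n (W : 'M[C]_n.+1) :
  spectral_unit_ball W <-> forall a, eigenvalue W a -> normc a < 1.
Proof.
have [] := @set_maxP R [set normc a | a in spectrum W].
- exact/finite_image/spectrum_finite.
- by have [a aW] := spectrum_neq0 W; exists (normc a), a.
move=> [a aW aE] maxW; split => [W1 b bW|W1];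
  last by rewrite /spectral_unit_ball /= /spectral_radius -aE W1.
by apply: le_lt_trans W1; apply: maxW; exists b.
Qed.

Lemma dist_MP a n (W : 'M[C]_n.+1) :
  0 <= dist_M a (spectrum W) /\
  forall b, eigenvalue W b -> dist_M a (spectrum W) <= mobius_dist a b.
Proof.
have [] := @set_minP R [set mobius_dist a b | b in spectrum W].
- exact/finite_image/spectrum_finite.
- by have [b bW] := spectrum_neq0 W; exists (mobius_dist a b), b.
move=> [b bW bE] minW; rewrite /dist_M; split=> [|c cW]; last by apply: minW; exists c.
by rewrite -bE mobius_dist_ge0.
Qed.

Lemma derivable_mx_holo m n (F : C^o -> 'M[C]_(m, n)) (z : C) i j :
  derivable F z 1 -> holo_at R (fun w => F w i j) z.
Proof.
move=> /derivable1_diffP dF; apply/derivable1_diffP.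
exact: (differentiable_comp dF (differentiable_coord (F z) i j)).
Qed.

Lemma derivable_scalar_mx n (z : C^o) :
  derivable (fun w : C^o => (w%:M : 'M[C]_n)) z 1.
Proof.
apply/cvg_ex; exists (1%:M : 'M[C]_n); apply: cvg_near_cst.
near=> h; rewrite /= -raddfB /= addrK scale_scalar_mx -[h *: 1]/(h * 1) mulr1 mulVf//.
by near: h; exact: nbhs_dnbhs_neq.
Unshelve. all: by end_near. Qed.

(** The Blaschke product over the roots of the minimal polynomial has [minpoly_degree (F z1)]
    factors, each at least the distance from [mu] to the spectrum. *)
Lemma spectral_schwarz n (F : C^o -> 'M[C]_n.+1) (z1 z2 : C) mu :
  holomorphic_maps (@unit_disc R) (@spectral_unit_ball R n.+1) F ->
  unit_disc z1 -> unit_disc z2 -> spectrum (F z2) mu ->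
  dist_M mu (spectrum (F z1)) ^+ minpoly_degree (F z1) <= mobius_dist z2 z1.
Proof.
move=> FH z1d z2d muF.
have [dist0 distM] := dist_MP mu n (F z1).
(* If the points coincide, [mu] is at distance 0 from the spectrum, and the power is 0 because the
   minimal polynomial has positive degree. *)
have [z12|z12] := eqVneq z2 z1.
  have -> : dist_M mu (spectrum (F z1)) = 0.
    apply/eqP; rewrite eq_le dist0 andbT.
    by move: muF; rewrite z12 => /distM; rewrite /mobius_dist subrr mul0r normc0.
  rewrite expr0n /minpoly_degree size_mxminpoly /= eqn0Ngt mxminpoly_nonconstant /=.
  exact: mobius_dist_ge0.
have [s sE] := closed_field_poly_normal (mxminpoly (F z1)).
move: sE; rewrite (monicP (mxminpoly_monic _)) scale1r => sE.
have -> : minpoly_degree (F z1) = size s.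
  by rewrite /minpoly_degree sE size_prod_XsubC.
have sF a : a \in s -> eigenvalue (F z1) a.
  by rewrite eigenvalue_root_min sE root_prod_XsubC.
apply: (@le_trans _ _ (\prod_(a <- s) mobius_dist mu a)).
  have -> (x : R) : x ^+ size s = \prod_(a <- s) x.
    by rewrite big_const_seq count_predT iter_mulr_1.
  rewrite !(big_seq_cond xpredT) /=.
  apply: ler_prod => a; rewrite andbT => /sF aF.
  by rewrite dist0 distM.
have spec z : unit_disc z -> forall a, eigenvalue (F z) a -> normc a < 1.
  by move=> zd; apply/spectral_unit_ballP; case: (FH z zd).
apply: (schwarz_blaschke _ _ F) => //.
- by move=> z zd i j; apply: derivable_mx_holo; case: (FH z zd).
- by move=> a /sF; exact: spec.
- by rewrite -sE mx_root_minpoly.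
Qed.

Lemma set_max_le (T : Type) (A : set T) (f : T -> R) (M : R) :
  finite_set A -> A !=set0 -> (forall x, A x -> f x <= M) ->
  set_max [set f x | x in A] <= M.
Proof.
move=> finA [a Aa] fM; have [||[x Ax <-] _] := @set_maxP R [set f x | x in A].
- exact: finite_image.
- by exists (f a), a.
- exact: fM.
Qed.

Lemma set_max1 (x : R) : set_max [set x] = x.
Proof. by have [||->] := @set_maxP R [set x]; [exact: finite_set1|exists x|]. Qed.

Lemma set_min1 (x : R) : set_min [set x] = x.
Proof. by have [||->] := @set_minP R [set x]; [exact: finite_set1|exists x|]. Qed.

Lemma spectrum_scalar n (z : C) : spectrum (z%:M : 'M[C]_n.+1) = [set z].
Proof.
apply/seteqP; split => a /=.
  move=> /eigenvalueP[v]; rewrite mul_mx_scalar => /eqP.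
  by rewrite -subr_eq0 -scalerBl scaler_eq0 subr_eq0 => /orP[/eqP ->//|/eqP
    ->]; rewrite eqxx.
move=> ->; apply/eigenvalueP; exists (const_mx 1); first by rewrite mul_mx_scalar.
by apply/eqP => /matrixP /(_ 0 0); rewrite !mxE => /eqP; rewrite oner_eq0.
Qed.

Lemma minpoly_degree_scalar n (z : C) : minpoly_degree (z%:M : 'M[C]_n.+1) = 1%N.
Proof.
apply/eqP; rewrite /minpoly_degree size_mxminpoly /= eqn_leq
  mxminpoly_nonconstant andbT.
by rewrite mxminpoly_linear_is_scalar scalar_mx_is_scalar.
Qed.

End SpectralBall.

(** * The inequality and its sharpness *)

Theorem theorem1p2 (R : realType) :
  (forall (n : nat) (F : R[i]^o -> 'M[R[i]]_n.+2) (z1 z2 : R[i]),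
     holomorphic_maps (@unit_disc R) (@spectral_unit_ball R n.+2) F ->
     unit_disc z1 -> unit_disc z2 ->
     let W1 := F z1 in
     let W2 := F z2 in
     let d1 := minpoly_degree W1 in
     let d2 := minpoly_degree W2 in
     Num.max
       (set_max [set dist_M mu (spectrum W1) ^+ d1 | mu in spectrum W2])
       (set_max [set dist_M la (spectrum W2) ^+ d2 | la in spectrum W1])
     <= mobius_dist z1 z2)
  /\
  (forall (n : nat) (z w : R[i]),
     unit_disc z -> unit_disc w ->
     exists2 F : R[i]^o -> 'M[R[i]]_n.+2,
       holomorphic_maps (@unit_disc R) (@spectral_unit_ball R n.+2) F &
       let dz := minpoly_degree (F z) in
       let dw := minpoly_degree (F w) in
       Num.max
         (set_max [set dist_M mu (spectrum (F z)) ^+ dz | mu in spectrum (F w)])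
         (set_max [set dist_M la (spectrum (F w)) ^+ dw | la in spectrum (F z)])
       = mobius_dist z w).
Proof.
split=> [n F z1 z2 FH z1d z2d|n z w zd wd].
  rewrite [X in is_true X]/= ge_max; apply/andP; split.
    apply: set_max_le; [exact: spectrum_finite|exact: spectrum_neq0|move=> mu muW].
    by rewrite mobius_distC; exact: spectral_schwarz.
  apply: set_max_le; [exact: spectrum_finite|exact: spectrum_neq0|move=> la laW].
  exact: spectral_schwarz.
(* A scalar matrix has a one-point spectrum and a minimal polynomial of degree 1, so every minimum,
   maximum and power collapses to the Moebius distance. *)
exists (fun z => z%:M) => [x xd|]; first split.
- apply/spectral_unit_ballP => a aW.
  have : spectrum (x%:M : 'M[R[i]]_n.+2) a by [].
  by rewrite spectrum_scalar => ->.
- exact: derivable_scalar_mx.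
rewrite /= !minpoly_degree_scalar !spectrum_scalar !image_set1 /dist_M !image_set1.
by rewrite !set_min1 !set_max1 !expr1 mobius_distC maxxx.
Qed.
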